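(* For any $5$-edge-connected graph $G=(V,E)$ (and any destination $t\in V$), there exists a $4$-resilient routing scheme against dynamic failures.
   Context: Graphs are finite undirected multigraphs; connectivity is edge-connectivity. Dynamic failures: a set $F\subseteq E$ of unstable links; each link of $F$ may alternate arbitrarily between up and down over time (when down it fails in both directions), including while a packet travels; links outside $F$ are always up. Routing scheme: for destination $t$, every node $v\ne t$ has a static deterministic forwarding function whose input is the in-port of the packet (or $\bot$ if the packet originates at $v$) and the set of links incident to $v$ that are currently up, and whose output is an outgoing link at $v$. No packet header rewriting and no knowledge of the source is used. A routing scheme for $t$ is $k$-resilient against dynamic failures if for every set $F$ of dynamic failures with $|F|\le k$, every packet originating at a node $s$ that is connected to $t$ in $G\setminus F$ (the graph with all of $F$ removed) is delivered to $t$, however the states of the links of $F$ evolve. *)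

(* Defs.v *)
From mathcomp Require Import all_boot.

Set Implicit Arguments.
Unset Strict Implicit.
Unset Printing Implicit Defensive.

(* Parallel links are distinct elements of [link] with the same endpoints.
   The order of the two components of [ends e] carries no meaning: every notion
   below is symmetric in them. *)
Record multigraph := Multigraph {
  node : finType;
  link : finType;
  ends : link -> node * node
}.

Section Connectivity.

Variable G : multigraph.

Definition incident (v : node G) (e : link G) : bool :=
  (v == (ends e).1) || (v == (ends e).2).

Definition links (v : node G) : {set link G} := [set e | incident v e].

(* The opposite end of [e]; only meaningful when [e] is incident to [v]. *)
Definition other_end (v : node G) (e : link G) : node G :=
  if v == (ends e).1 then (ends e).2 else (ends e).1.

Definition adjacent_without (F : {set link G}) : rel (node G) :=
  fun u v => [exists e, [&& e \notin F, incident u e & other_end u e == v]].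

Definition connected_without (F : {set link G}) : rel (node G) :=
  connect (adjacent_without F).

Definition edge_connected (k : nat) : Prop :=
  forall F : {set link G}, #|F| < k ->
  forall u v : node G, connected_without F u v.

End Connectivity.

Section Routing.

Variables (G : multigraph) (t : node G).

(* [f v p U] is the link chosen at [v] for a packet with in-port [p]
   ([None] if it originates at [v]) when [U] is the set of links incident
   to [v] that are up. The result is an option only because a node without
   incident links has nothing to output. *)
Definition forwarding := node G -> option (link G) -> {set link G} ->
  option (link G).

Definition routing_scheme (f : forwarding) : Prop :=
  forall (v : node G) (p : option (link G)) (U : {set link G}),
    v != t -> links v != set0 ->
    exists2 e, e \in links v & f v p U = Some e.

(* A packet is given by its current node and its in-port; [None] stands for a
   lost packet. [D] is the set of links that are down during this hop. A packet
   sent over a link that is down is lost. *)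
Definition hop (f : forwarding) (D : {set link G})
    (x : node G * option (link G)) : option (node G * option (link G)) :=
  let U := links x.1 :\: D in
  if f x.1 x.2 U is Some e then
    if e \in U then Some (other_end x.1 e, Some e) else None
  else None.

Fixpoint packet (f : forwarding) (D : nat -> {set link G}) (s : node G)
    (n : nat) : option (node G * option (link G)) :=
  if n is m.+1 then obind (hop f (D m)) (packet f D s m)
  else Some (s, None).

(* The trajectory is not stopped at [t], but its part up to the first visit of
   [t] does not depend on [f t], so neither does delivery. *)
Definition delivered (f : forwarding) (D : nat -> {set link G})
    (s : node G) : Prop :=
  exists n p, packet f D s n = Some (t, p).

(* [D n] is the set of links that are down during hop [n]: an arbitrary,
   time-varying subset of the set [F] of unstable links. *)
Definition dynamically_resilient (k : nat) (f : forwarding) : Prop :=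
  forall F : {set link G}, #|F| <= k ->
  forall D : nat -> {set link G}, (forall n, D n \subset F) ->
  forall s : node G, connected_without F s t -> delivered f D s.

End Routing.

(* Main.v *)
Require Import Defs.
From mathcomp Require Import all_boot.
From mathcomp Require Import zify.

(** Each link is split into two opposite darts, and the darts are coloured with
    five colours: two pairs [Some (x, _)] and a single colour [None]. In a
    suitable colouring the two darts of a link never have the same colour or the
    two colours of one pair, and for every colour each vertex reaches the
    destination along darts of that colour. A packet follows [None] until it
    meets a down link, bounces onto the colour of the reverse dart, and from then
    on cycles through the four paired colours, alternating between the pairs. If
    one link blocks two colours, it blocks them in opposite directions, so they
    belong to different pairs; moreover two consecutive blocked links differ,
    since otherwise the packet would move away from the destination while
    following a shortest path. These constraints cannot be met by a blocking
    sequence confined to four links.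

    The colouring is found by induction on the number of links, in the manner of
    Mader's splitting theorem. If no link can be deleted, every link crosses a
    tight vertex set, that is, a set avoiding [t] with exactly five leaving
    links. Inside a minimal tight set with at least two vertices the links cross
    only singleton tight sets. Hence one can delete a link and split off the four
    remaining links at one of its ends, or at both; the only exception is a
    5-cycle of double links with one further link at each vertex, which is
    contracted. When a split vertex is put back, it gets at least four of the
    colours from the links that pass through it, and the deleted link supplies
    the missing one. *)

Set Implicit Arguments.
Unset Strict Implicit.
Unset Printing Implicit Defensive.

(** * Coloured darts *)

Definition color := option (bool * bool).

(* [None] forms a class of its own. *)
Definition cl (c : color) : option bool := omap fst c.

Definition compat (c d : color) : bool := cl c != cl d.

Lemma compatC c d : compat c d = compat d c.
Proof. by rewrite /compat eq_sym. Qed.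

Section Darts.

Variables (V L : finType) (t : V).

Definition dart : Type := (L * bool)%type.

Definition rv (d : dart) : dart := (d.1, ~~ d.2).

Lemma rvK : involutive rv.
Proof. by case=> l b; rewrite /rv /= negbK. Qed.

Lemma rv_neq d : rv d != d.
Proof. by case: d => l b; rewrite xpair_eqE eqxx; case: b. Qed.

Implicit Types (src : dart -> V) (A : {set L}) (col : dart -> color).
Implicit Types (U S W : {set V}).

Definition compatible col : Prop := forall d, compat (col d) (col (rv d)).

Definition arc src A col c : rel V := fun u v =>
  [exists d : dart, [&& d.1 \in A, src d == u, src (rv d) == v & col d == c]].

Fact reach_key : unit. Proof. exact: tt. Qed.

(* Locked, since [connect] computes. *)
Definition reach := locked_with reach_key
  (fun src A col c v => connect (arc src A col c) v t).

Lemma reachE src A col c v : reach src A col c v = connect (arc src A col c) v t.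
Proof. by rewrite /reach unlock. Qed.

(** A walk along these arcs never leaves [z], so it survives any recolouring of the darts leaving
    [z]. *)
Definition arc_off src A col c z : rel V :=
  fun u v => (u != z) && arc src A col c u v.

Definition recolor col d c : dart -> color := fun x => if x == d then c else col x.

Lemma arcP src A col c u v :
  reflect (exists d, [/\ d.1 \in A, src d = u, src (rv d) = v & col d = c])
          (arc src A col c u v).
Proof.
apply: (iffP existsP) => [[d /and4P[dA /eqP<- /eqP<- /eqP<-]]|]; first by exists d.
by case=> d [dA <- <- <-]; exists d; rewrite dA !eqxx.
Qed.

Lemma dart_arc src A col d : d.1 \in A -> arc src A col (col d) (src d) (src (rv d)).
Proof. by move=> dA; apply/arcP; exists d. Qed.

Lemma reach_root src A col c : reach src A col c t.
Proof. by rewrite reachE. Qed.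

Lemma reach_dart src A col c d : d.1 \in A -> col d = c ->
  reach src A col c (src (rv d)) -> reach src A col c (src d).
Proof.
move=> dA <-; rewrite !reachE => h; apply: connect_trans h; exact/connect1/dart_arc.
Qed.

Lemma reach_ind src A col c (Q : V -> Prop) : Q t ->
  (forall d, d.1 \in A -> col d = c -> Q (src (rv d)) -> Q (src d)) ->
  forall v, reach src A col c v -> Q v.
Proof.
move=> Qt QS v; rewrite reachE => /connectP[p]; elim: p v => [|w p IH] v /=; first by move=> _ <-.
by case/andP=> /arcP[d [dA <- <- dc]] pp /(IH _ pp); apply: QS.
Qed.

Lemma reach_mono src A col src' A' col' c :
  (forall d, d.1 \in A -> col d = c ->
    reach src' A' col' c (src (rv d)) -> reach src' A' col' c (src d)) ->
  forall v, reach src A col c v -> reach src' A' col' c v.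
Proof. by move=> h; apply: reach_ind => //; exact: reach_root. Qed.

(** Only [d] loses the colour [col d], and its source still has that colour by another route, so
    every old walk can be repaired there. *)
Lemma recolor_reach src A col d j :
  reach src A (recolor col d j) (col d) (src d) ->
  forall c v, reach src A col c v -> reach src A (recolor col d j) c v.
Proof.
move=> h c; apply: reach_mono => x xA xc.
have [xd|xd] := eqVneq x d; first by rewrite xd in xc *; rewrite -xc.
by apply: reach_dart => //; rewrite /recolor (negbTE xd).
Qed.

Lemma off_reach src A A' col col' c z v :
  {subset A <= A'} -> (forall d, src d != z -> d.1 \in A -> col' d = col d) ->
  connect (arc_off src A col c z) v t -> reach src A' col' c v.
Proof.
move=> sA ag; rewrite reachE; apply: (connect_sub (e := arc_off src A col c z)).
move=> u w /andP[uz /arcP[d [dA du dw dc]]]; apply/connect1/arcP.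
by exists d; split=> //; [exact: sA | rewrite ag // du].
Qed.

(** A simple path to the root does not return to its first vertex. *)
Lemma off_first src A col c v : v != t -> reach src A col c v ->
  exists d, [/\ d.1 \in A, src d = v, col d = c &
                connect (arc_off src A col c v) (src (rv d)) t].
Proof.
move=> vt; rewrite reachE => /connectP[p0 pp0 tE]; move: pp0 tE; case/shortenP => p pp up _ tE.
case: p pp up tE => [|w p] /=; first by move=> _ _ tv; rewrite tv eqxx in vt.
case/andP=> /arcP[d [dA dv dw dc]] pp /andP[vp _] tE.
exists d; split=> //; rewrite dw; apply/connectP; exists p => //.
elim: p w vp {dw tE} pp => //= x p IH w; rewrite !inE !negb_or => /and3P[vw vx vp].
by case/andP=> a pp; rewrite /arc_off eq_sym vw a /= IH // !inE negb_or vx.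
Qed.

(** A simple path from [v] either misses [w], or its part from [w] on misses [v]. *)
Lemma off_either src A col c v w : v != w -> reach src A col c v ->
  connect (arc_off src A col c w) v t \/ connect (arc_off src A col c v) w t.
Proof.
move=> vw; rewrite reachE => /connectP[p0 pp0 tE]; move: pp0 tE; case/shortenP => p pp up _ tE.
have off x u q : path (arc src A col c) u q -> x \notin u :: q ->
    connect (arc_off src A col c x) u (last u q).
  move=> pq xq; apply/connectP; exists q => //.
  elim: q u pq xq => //= y q IH u /andP[a pq]; rewrite !inE !negb_or.
  case/and3P=> xu xy xq; rewrite /arc_off eq_sym xu a /= IH //.
  by rewrite !inE negb_or xy.
have [wp|wp] := boolP (w \in v :: p); last by left; rewrite tE; apply: off.
move: wp; rewrite inE eq_sym (negbTE vw) /= => wp; right.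
case/splitPr: wp pp up tE => p1 p2; rewrite cat_path /= => /and3P[_ _ pp].
rewrite cat_uniq mem_cat negb_or !inE !negb_or => /andP[/and3P[_ _ vp2] _].
by rewrite last_cat /= => ->; apply: off; rewrite // inE negb_or vw.
Qed.

Lemma off_recolor src A col c d j v :
  connect (arc_off src A col c (src d)) v t -> reach src A (recolor col d j) c v.
Proof.
apply: off_reach => // x xd _; rewrite /recolor; case: eqP => // xE.
by rewrite xE eqxx in xd.
Qed.

(* Of two equally coloured darts leaving [z], one does not start a shortest path
   to the root and can be recoloured. *)
Lemma free_dart src A col z d e j : z != t -> reach src A col (col d) z ->
  src d = z -> src e = z -> d != e -> col e = col d ->
  reach src A (recolor col d j) (col d) z \/ reach src A (recolor col e j) (col d) z.
Proof.
move=> zt rz dz ez de ce; have [x [xA xz xc off]] := off_first zt rz.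
have [xd|xd] := eqVneq x d; [right|left]; rewrite -xz.
  apply: reach_dart => //; first by rewrite /recolor xd (negbTE de).
  by apply: off_recolor; rewrite ez.
apply: reach_dart => //; first by rewrite /recolor (negbTE xd).
by apply: off_recolor; rewrite dz.
Qed.

End Darts.

(** * Reinserting a vertex of degree four *)

(** A fixed colour compatible with [c], depending only on the class of [c]. *)
Definition switch (c : color) : color :=
  if c is None then Some (false, false) else None.

Section Insertion.

Variables (V L : finType) (t : V) (src : dart L -> V) (A : {set L}).
Implicit Types (col : dart L -> color) (z : V).

Lemma compatible_recolor col d j : compatible col -> compat j (col (rv d)) ->
  compatible (recolor col d j).
Proof.
move=> pc cj x; rewrite /recolor.
have [->|xd] := eqVneq x d; first by rewrite (negbTE (rv_neq d)).
case: eqP => [xE|_]; last exact: pc.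
by move: cj; rewrite -xE rvK compatC.
Qed.

(** If both darts have the same colour, a walk from [z] needs only one of them, and the other can
    take the partner colour. The classes do not change, so compatibility persists. *)
Lemma complete_class col z d e x : z != t -> compatible col -> d != e ->
  (forall y : dart L, y \in [:: d; e] -> [/\ y.1 \in A, src y = z, cl (col y) = Some x &
     forall c : color, reach t src A col c (src (rv y))]) ->
  exists col', [/\ forall y, y \notin [:: d; e] -> col' y = col y,
    compatible col',
    forall y, y \in [:: d; e] -> cl (col' y) = Some x,
    forall c v, reach t src A col c v -> reach t src A col' c v &
    forall b, exists2 y, y \in [:: d; e] & col' y = Some (x, b)].
Proof.
move=> zt pc de H.
have d_in : d \in [:: d; e] by rewrite inE eqxx.
have e_in : e \in [:: d; e] by rewrite !inE eqxx orbT.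
have [dA dz dx dr] := H d d_in; have [eA ez ex er] := H e e_in.
case dE: (col d) dx => [[x1 b1]|] //= [x1x]; case eE: (col e) ex => [[x2 b2]|] //= [x2x].
rewrite {}x1x in dE; rewrite {}x2x in eE.
have [bE|bN] := eqVneq b2 b1; last first.
  exists col; split=> //; first by move=> y /H[].
  move=> b; have [->|bb] := eqVneq b b1; first by exists d.
  by exists e => //; rewrite eE; congr (Some (_, _)); case: b b1 b2 bb bN {eE dE} => [] [] [].
rewrite {}bE in eE.
have rz : reach t src A col (col d) z by rewrite -dz; apply: reach_dart => //; exact: dr.
have good y y' : [:: d; e] =i [:: y; y'] -> y != y' -> src y = z ->
    col y = Some (x, b1) -> col y' = Some (x, b1) ->
    reach t src A (recolor col y (Some (x, ~~ b1))) (Some (x, b1)) z ->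
    exists col', [/\ forall y, y \notin [:: d; e] -> col' y = col y,
    compatible col',
    forall y, y \in [:: d; e] -> cl (col' y) = Some x,
    forall c v, reach t src A col c v -> reach t src A col' c v &
    forall b, exists2 y, y \in [:: d; e] & col' y = Some (x, b)].
  move=> sy yy' yz yc y'c ry; exists (recolor col y (Some (x, ~~ b1))).
  have y'y : y' != y by rewrite eq_sym.
  split=> [w|||c v|b].
  - by rewrite sy !inE negb_or /recolor => /andP[/negbTE-> _].
  - by apply: compatible_recolor => //; move: (pc y); rewrite yc.
  - by move=> w; rewrite sy !inE /recolor; case: eqP => //= _ /eqP->; rewrite y'c.
  - by move=> h; apply: (recolor_reach (d := y)) h; rewrite yz yc.
  - have [->|bb] := eqVneq b b1.
      by exists y'; rewrite ?sy ?inE ?eqxx ?orbT // /recolor (negbTE y'y).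
    exists y; rewrite ?sy ?mem_head // /recolor eqxx.
    by congr (Some (_, _)); case: b b1 bb {eE dE yc y'c ry} => [] [].
have ed : [:: d; e] =i [:: e; d] by move=> w; rewrite !inE orbC.
have [||] := @free_dart _ _ t src A col z d e (Some (x, ~~ b1)) zt rz dz ez de.
- by rewrite eE dE.
- by rewrite dE; apply: (good d e).
- by rewrite dE; apply: (good e d) => //; rewrite eq_sym.
Qed.

Definition ports col z (s : seq (dart L)) : Prop :=
  forall y, y \in s -> [/\ y.1 \in A, src y = z, src (rv y) != z &
    forall c : color, reach t src A col c (src (rv y))].

(* Every colour but [c] leads from [z] to the root; as [rv y] is compatible with
   [c], the dart [y] may be recoloured from [switch c] to [c] as soon as [z] has
   another dart of colour [switch c]. *)
Definition completed col z (s : seq (dart L)) : Prop :=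
  exists col' c, [/\ forall y, y \notin s -> col' y = col y, compatible col',
    forall k v, reach t src A col k v -> reach t src A col' k v,
    forall k, k != c -> reach t src A col' k z &
    exists y, [/\ y \in s, col' y = switch c & compat (col' (rv y)) c]].

(* The links [a1], [a2] (and [b1], [b2]) come from a single link, subdivided by [z]. *)
Definition subdivided col z (a1 a2 b1 b2 : dart L) : Prop :=
  [/\ uniq [:: a1; a2; b1; b2], ports col z [:: a1; a2; b1; b2],
      col (rv a1) = col a2, col (rv a2) = col a1 &
      col (rv b1) = col b2 /\ col (rv b2) = col b1].

Lemma completed_mem col z s s' : s =i s' -> completed col z s -> completed col z s'.
Proof.
move=> ss' [col' [c [h1 h2 h3 h4 [y [ys yc yk]]]]]; exists col', c; split=> //.
  by move=> w; rewrite -ss'; apply: h1.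
by exists y; rewrite -ss'.
Qed.

Lemma ports_mem col z s s' : s =i s' -> ports col z s -> ports col z s'.
Proof. by move=> ss' h y; rewrite -ss'; apply: h. Qed.

Lemma subdivided_swap col z a1 a2 b1 b2 :
  subdivided col z a1 a2 b1 b2 -> subdivided col z b1 b2 a1 a2.
Proof.
case=> u p e1 e2 [e3 e4]; split=> //.
  by move: u; rewrite -(rot_uniq 2).
by apply: ports_mem p => y; rewrite (mem_rot 2 [:: b1; b2; a1; a2]).
Qed.

Lemma subdivided_flip col z a1 a2 b1 b2 :
  subdivided col z a1 a2 b1 b2 -> subdivided col z a2 a1 b1 b2.
Proof.
case=> u p e1 e2 [e3 e4]; split=> //.
  by move: u; rewrite /= !inE !negb_or eq_sym => /and4P[/and3P[-> -> ->] /andP[-> ->] -> _].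
by apply: ports_mem p => y; rewrite !inE orbCA.
Qed.

Lemma completed_swap col z a1 a2 b1 b2 :
  completed col z [:: b1; b2; a1; a2] -> completed col z [:: a1; a2; b1; b2].
Proof. by apply: completed_mem => y; rewrite (mem_rot 2 [:: a1; a2; b1; b2]). Qed.

Lemma completed_flip col z a1 a2 b1 b2 :
  completed col z [:: a2; a1; b1; b2] -> completed col z [:: a1; a2; b1; b2].
Proof. by apply: completed_mem => y; rewrite !inE orbCA. Qed.

Lemma ports_rv col z s y : ports col z s -> y \in s -> rv y \notin s.
Proof.
move=> p ys; apply/negP => /p[_ yz _ _].
by have [_ _ + _] := p _ ys; rewrite yz eqxx.
Qed.

(** * Completion at a vertex, by the colour classes of the two subdivided links *)

Section Cases.

Variables (col : dart L -> color) (z : V) (a1 a2 b1 b2 : dart L).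
Hypotheses (zt : z != t) (pc : compatible col) (sd : subdivided col z a1 a2 b1 b2).

Let s := [:: a1; a2; b1; b2].

Let distinct : [/\ a1 != a2, a1 != b1, a1 != b2, a2 != b1 & a2 != b2 /\ b1 != b2].
Proof.
case: sd => + _ _ _ _; rewrite /= !inE !negb_or.
by case/and4P=> /and3P[-> -> ->] /andP[-> ->] ->.
Qed.

Let ports_s : ports col z s. Proof. by case: sd. Qed.

Let in_s : [/\ a1 \in s, a2 \in s, b1 \in s & b2 \in s].
Proof. by rewrite !inE !eqxx !orbT. Qed.

Let stable col' : (forall y, y \notin s -> col' y = col y) ->
  forall y, y \in s -> col' (rv y) = col (rv y).
Proof. by move=> h y ys; apply/h/(ports_rv ports_s). Qed.

Let mix x d e : d \in s -> e \in s -> d != e ->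
  cl (col d) = Some x -> cl (col e) = Some x ->
  exists col', [/\ forall y, y \notin [:: d; e] -> col' y = col y,
    compatible col',
    forall c v, reach t src A col c v -> reach t src A col' c v &
    forall b, exists2 y, y \in [:: d; e] & col' y = Some (x, b)].
Proof.
move=> ds es de dx ex.
have [|col' [h1 h2 h3 h4 h5]] := @complete_class col z d e x zt pc de.
  by move=> y; rewrite !inE => /orP[]/eqP->; [have [] := ports_s ds | have [] := ports_s es].
by exists col'.
Qed.

Let reach_port col' y c :
  (forall c v, reach t src A col c v -> reach t src A col' c v) ->
  y \in s -> col' y = c -> reach t src A col' c z.
Proof.
move=> mono ys yc; have [yA <- _ yr] := ports_s ys.
by apply: reach_dart yc _ => //; apply: mono.
Qed.

(** Each pair of colours leaves [z] twice and can be made complete. Only [None] is missing, and the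
    reverses of the four ports all have paired colours. *)
Lemma complete_two_plain x : cl (col a1) = Some x -> cl (col b1) = Some x ->
  cl (col a2) = Some (~~ x) -> cl (col b2) = Some (~~ x) -> completed col z s.
Proof.
move=> a1x b1x a2x b2x; have [a12 ab1 ab2 a2b1 [a2b2 b12]] := distinct.
have [a1s a2s b1s b2s] := in_s.
have [c1 [k1 p1 m1 f1]] := mix a1s b1s ab1 a1x b1x.
have a2n : a2 \notin [:: a1; b1] by rewrite !inE negb_or eq_sym a12.
have b2n : b2 \notin [:: a1; b1] by rewrite !inE negb_or ![b2 == _]eq_sym ab2.
have [|c2 [k2 p2 _ m2 f2]] := @complete_class c1 z a2 b2 (~~ x) zt p1 a2b2.
  move=> y; rewrite !inE => /orP[]/eqP->; rewrite k1 //.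
    by have [? ? _ yr] := ports_s a2s; split=> // c; apply/m1/yr.
  by have [? ? _ yr] := ports_s b2s; split=> // c; apply/m1/yr.
have kk y : y \notin s -> c2 y = col y.
  rewrite !inE !negb_or => /and4P[? ? ? ?].
  by rewrite k2 ?k1 // !inE negb_or; apply/andP.
have mm c v : reach t src A col c v -> reach t src A c2 c v by move/m1/m2.
have full b : forall w : bool, exists2 y, y \in s & c2 y = Some (w, b).
  move=> w; have [->|wx] := eqVneq w x.
    have [y ys yc] := f1 b; exists y; first by move: ys; rewrite !inE => /orP[]->; rewrite ?orbT.
    rewrite k2 //; move: ys; rewrite !inE negb_or => /orP[]/eqP->.
      by rewrite a12 ab2.
    by rewrite eq_sym a2b1 b12.
  have -> : w = ~~ x by case: w x wx {a1x b1x a2x b2x k1 p1 m1 f1 k2 p2 m2 f2 kk mm} => [] [].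
  have [y ys yc] := f2 b; exists y => //.
  by move: ys; rewrite !inE => /orP[]->; rewrite ?orbT.
exists c2, None; split=> //.
  move=> [[w b]|] // _; have [y ys yc] := full b w; exact: reach_port yc.
have [y ys yc] := full false false; exists y; split=> //.
rewrite stable //; have [_ _ ea1 ea2 [eb1 eb2]] := sd.
move: ys; rewrite !inE /compat => /or4P[]/eqP->;
  by rewrite ?ea1 ?ea2 ?eb1 ?eb2 ?a1x ?a2x ?b1x ?b2x.
Qed.

(** The ports of class [x] yield both colours of that pair, [b2] yields [None] and [a2] one colour
    of the other pair, whose partner is missing. The spare dart is [b2], as its reverse has class
    [x]. *)
Lemma complete_one_plain x y : cl (col a1) = Some x -> cl (col b1) = Some x ->
  col a2 = Some (~~ x, y) -> col b2 = None -> completed col z s.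
Proof.
move=> a1x b1x a2E b2E; have [a12 ab1 ab2 a2b1 [a2b2 b12]] := distinct.
have [a1s a2s b1s b2s] := in_s.
have [c1 [k1 p1 m1 f1]] := mix a1s b1s ab1 a1x b1x.
have a2n : a2 \notin [:: a1; b1] by rewrite !inE negb_or eq_sym a12.
have b2n : b2 \notin [:: a1; b1] by rewrite !inE negb_or ![b2 == _]eq_sym ab2.
have kk w : w \notin s -> c1 w = col w.
  rewrite !inE !negb_or => /and4P[? ? ? ?].
  by rewrite k1 // !inE negb_or; apply/andP.
exists c1, (Some (~~ x, ~~ y)); split=> //.
  move=> [[w b]|]; last by move=> _; apply: (@reach_port c1 b2); rewrite ?k1.
  have [->|wx] := eqVneq w x => cN.
    have [d ds dc] := f1 b; apply: reach_port dc => //.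
    by move: ds; rewrite !inE => /orP[]->; rewrite ?orbT.
  apply: (@reach_port c1 a2); rewrite // k1 // a2E.
  by congr (Some (_, _)); case: w x b y wx cN {a1x b1x a2E k1 p1 m1 f1 kk} => [] [] [] [].
exists b2; split=> //; first by rewrite k1.
rewrite stable //; have [_ _ _ _ [_ ->]] := sd.
by rewrite /compat b1x /=; case: (x).
Qed.

(** One of the two ports coloured [None] suffices for [None]; the other takes a colour of class
    [~~ x], which its reverse of class [x] permits. *)
Lemma complete_mixed_same x : cl (col a1) = Some x -> cl (col b1) = Some x ->
  col a2 = None -> col b2 = None -> completed col z s.
Proof.
move=> a1x b1x a2E b2E; have [a12 ab1 ab2 a2b1 [a2b2 b12]] := distinct.
have [a1s a2s b1s b2s] := in_s.
have [_ _ ea1 ea2 [eb1 eb2]] := sd.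
have [c1 [k1 p1 m1 f1]] := mix a1s b1s ab1 a1x b1x.
have a2n : a2 \notin [:: a1; b1] by rewrite !inE negb_or eq_sym a12.
have b2n : b2 \notin [:: a1; b1] by rewrite !inE negb_or ![b2 == _]eq_sym ab2.
have kk w : w \notin s -> c1 w = col w.
  rewrite !inE !negb_or => /and4P[? ? ? ?].
  by rewrite k1 // !inE negb_or; apply/andP.
have [[_ a2z _ _] [_ b2z _ _]] := (ports_s a2s, ports_s b2s).
pose j : color := Some (~~ x, false).
have good d e : d \in [:: a2; b2] -> e \in [:: a2; b2] -> d != e ->
    reach t src A (recolor c1 d j) (c1 d) z -> completed col z s.
  move=> d2 e2 de rd.
  have in2 w : w \in [:: a2; b2] -> [/\ w \in s, w \notin [:: a1; b1], col w = None,
      cl (col (rv w)) = Some x & src w = z].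
    move=> w2; have [->|->] : w = a2 \/ w = b2.
        by move: w2; rewrite !inE => /orP[]/eqP; [left|right].
      by split=> //; rewrite ea2.
    by split=> //; rewrite eb2.
  have [ds dn dE dx dz] := in2 d d2; have [es en eE ex ez] := in2 e e2.
  have mm c v : reach t src A col c v -> reach t src A (recolor c1 d j) c v.
    by move/m1 => h; apply: (recolor_reach (d := d)) h; rewrite dz.
  have kd w : w \notin s -> recolor c1 d j w = col w.
    move=> ws; rewrite /recolor; case: eqP => [wd|_]; last exact: kk.
    by rewrite wd ds in ws.
  exists (recolor c1 d j), (Some (~~ x, true)); split=> //.
  - apply: compatible_recolor => //; rewrite kk ?(ports_rv ports_s) //.
    by rewrite /compat dx /j; case: (x).
  - move=> [[w b]|]; last first.
      move=> _; apply: (@reach_port _ e); rewrite // /recolor eq_sym (negbTE de).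
      by rewrite k1.
    have [->|wx] := eqVneq w x => cN.
      have [y ys yc] := f1 b; apply: (@reach_port _ y) => //.
        by move: ys; rewrite !inE => /orP[]->; rewrite ?orbT.
      by rewrite /recolor; case: eqP => // yd; rewrite -yd ys in dn.
    apply: (@reach_port _ d); rewrite // /recolor eqxx.
    by congr (Some (_, _));
      case: w x b wx cN {a1x b1x k1 p1 m1 f1 kk j rd in2 dx ex mm kd} => [] [] [].
  exists e; split=> //; first by rewrite /recolor eq_sym (negbTE de) k1.
  by rewrite stable // /compat ex; case: (x).
have rz : reach t src A c1 (c1 a2) z by apply: (reach_port (y := a2)).
have c12 : c1 b2 = c1 a2 by rewrite !k1 // a2E b2E.
have [] := @free_dart _ _ t src A c1 z a2 b2 j zt rz a2z b2z a2b2 c12.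
  by apply: (good a2 b2) => //; rewrite !inE eqxx ?orbT.
by rewrite -c12; apply: (good b2 a2); rewrite ?inE ?eqxx ?orbT // eq_sym.
Qed.

(** By the last hypothesis [b2] can be spared for [None]. It takes the partner of [col a1], and only
    the partner of [col b1] remains missing. *)
Lemma complete_mixed_opposite x y y' : col a1 = Some (x, y) -> col b1 = Some (~~ x, y') ->
  col a2 = None -> col b2 = None ->
  reach t src A (recolor col b2 (Some (x, ~~ y))) (col b2) z -> completed col z s.
Proof.
move=> a1E b1E a2E b2E rb; have [a12 ab1 ab2 a2b1 [a2b2 b12]] := distinct.
have [a1s a2s b1s b2s] := in_s; have [_ _ ea1 ea2 [eb1 eb2]] := sd.
have [_ b2z _ _] := ports_s b2s.
have mm c v : reach t src A col c v -> reach t src A (recolor col b2 (Some (x, ~~ y))) c v.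
  by move=> h; apply: (recolor_reach (d := b2)) h; rewrite b2z.
have kd w : w \notin s -> recolor col b2 (Some (x, ~~ y)) w = col w.
  by move=> ws; rewrite /recolor; case: eqP => // wb; rewrite wb b2s in ws.
exists (recolor col b2 (Some (x, ~~ y))), (Some (~~ x, ~~ y')); split=> //.
- by apply: compatible_recolor; rewrite // eb2 b1E /compat /=; case: (x).
- move=> [[w b]|]; last first.
    by move=> _; apply: (@reach_port _ a2); rewrite // /recolor (negbTE a2b2).
  have [->|wx] := eqVneq w x => cN.
    have [->|by_] := eqVneq b y.
      by apply: (@reach_port _ a1); rewrite // /recolor (negbTE ab2).
    apply: (@reach_port _ b2); rewrite // /recolor eqxx.
    by congr (Some (_, _)); move: by_ {cN}; case: b (y) => [] [].
  apply: (@reach_port _ b1); rewrite // /recolor (negbTE b12) b1E.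
  by congr (Some (_, _)); case: w (x) b (y') wx cN => [] [] [] [].
exists a2; split=> //; first by rewrite /recolor (negbTE a2b2).
by rewrite stable // ea2 a1E /compat; case: (x).
Qed.

End Cases.

(** The two colours of a subdivided link are compatible: they come either from the two different
    pairs or from one pair and [None]. Swapping the links and flipping each of them leads to one of
    the four cases above. *)
Lemma completion col z a1 a2 b1 b2 : z != t -> compatible col ->
  subdivided col z a1 a2 b1 b2 -> completed col z [:: a1; a2; b1; b2].
Proof.
move=> zt pc.
have orient c1 c2 d1 d2 x : subdivided col z c1 c2 d1 d2 ->
    cl (col c1) != None -> cl (col c2) != None ->
    exists c c', [/\ cl (col c) = Some x, cl (col c') = Some (~~ x),
      subdivided col z c c' d1 d2 &
      completed col z [:: c; c'; d1; d2] -> completed col z [:: c1; c2; d1; d2]].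
  move=> sd; have [_ _ e1 e2 _] := sd; move: (pc c1); rewrite e1 /compat.
  case c1E: (col c1) => [[x1 y1]|] //; case c2E: (col c2) => [[x2 y2]|] //= x12 _ _.
  have [xE|xN] := eqVneq x1 x.
    exists c1, c2; rewrite c1E c2E /= xE; split=> //; congr Some.
    by case: x1 x2 x x12 xE {c1E c2E} => [] [] [].
  exists c2, c1; split; rewrite ?c1E ?c2E /=; first last.
  - exact: completed_flip.
  - exact: subdivided_flip.
  - by congr Some; case: x1 x2 x x12 xN {c1E c2E} => [] [] [].
  - by congr Some; case: x1 x2 x x12 xN {c1E c2E} => [] [] [].
have plain c1 c2 d1 d2 x : subdivided col z c1 c2 d1 d2 -> cl (col d1) = Some x ->
    cl (col d2) != Some x -> cl (col c1) != None -> cl (col c2) != None ->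
    completed col z [:: c1; c2; d1; d2].
  move=> sd d1x d2x n1 n2; have [c [c' [cx c'x sd' fin]]] := orient _ _ _ _ x sd n1 n2; apply: fin.
  case d2E: (col d2) d2x => [[x2 y2]|] /= d2x.
    apply: (complete_two_plain zt pc sd' (x := x)) => //; rewrite d2E; congr Some.
    by case: x2 x d2x {d1x cx c'x d2E} => [] [].
  case c'E: (col c') c'x => [[x' y']|] //= [x'x]; rewrite x'x in c'E.
  exact: (complete_one_plain zt pc sd' (x := x) (y := y')).
have some c c' : compat c c' -> c' = None -> exists x y, c = Some (x, y).
  by case: c => [[x y]|]; [exists x, y | move=> + c'E; rewrite c'E].
have mixed c1 c2 d1 d2 : subdivided col z c1 c2 d1 d2 -> col c2 = None ->
    col d2 = None -> completed col z [:: c1; c2; d1; d2].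
  move=> sd c2E d2E; have [u p e1 _ [e3 _]] := sd.
  have [|x [y c1E]] := some (col c1) (col c2) _ c2E; first by rewrite -e1.
  have [|x' [y' d1E]] := some (col d1) (col d2) _ d2E; first by rewrite -e3.
  have [xE|xN] := eqVneq x' x.
    by apply: (complete_mixed_same zt pc sd (x := x)); rewrite // ?c1E // d1E xE.
  have x'E : x' = ~~ x by case: x x' xN {c1E d1E} => [] [].
  rewrite {}x'E in d1E.
  have /p[c2A c2z _ c2r] : c2 \in [:: c1; c2; d1; d2] by rewrite !inE eqxx ?orbT.
  have /p[d2A d2z _ _] : d2 \in [:: c1; c2; d1; d2] by rewrite !inE eqxx ?orbT.
  have cd2 : c2 != d2 by move: u; rewrite /= !inE !negb_or => /and4P[_ /andP[]].
  have rz : reach t src A col (col d2) z.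
    by rewrite d2E -c2z; apply: reach_dart c2E _.
  have [d2r|c2r'] := boolP (reach t src A (recolor col d2 (Some (x, ~~ y))) None z).
    by apply: (complete_mixed_opposite pc sd c1E d1E); rewrite // d2E.
  (* If [d2] cannot be spared, a [None] walk that leaves [z] for good must start with [d2], so [c2]
     can be spared instead. *)
  have off := off_first zt rz; have {off} [w [wA wz wc off]] := off.
  apply: completed_swap.
  apply: (complete_mixed_opposite pc (subdivided_swap sd) d1E (y' := y)); rewrite ?negbK //.
  have wd2 : w = d2.
    apply/eqP; apply: contraNT c2r' => wd2; rewrite -wz.
    apply: reach_dart => //; first by rewrite /recolor (negbTE wd2) wc d2E.
    by rewrite -d2E; apply: off_recolor; rewrite d2z.
  rewrite c2E -wz; apply: reach_dart; rewrite // ?wd2.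
    by rewrite /recolor eq_sym (negbTE cd2).
  by rewrite wd2 in off; rewrite -d2E; apply: off_recolor; rewrite c2z.
have nonplain c1 c2 d1 d2 : subdivided col z c1 c2 d1 d2 ->
    (cl (col c1) == None) || (cl (col c2) == None) ->
    exists c c', [/\ col c' = None, subdivided col z c c' d1 d2 &
      completed col z [:: c; c'; d1; d2] -> completed col z [:: c1; c2; d1; d2]].
  move=> sd /orP[]; [case c1E: (col c1) => [//|] _|case c2E: (col c2) => [//|] _].
    by exists c2, c1; split=> //; [exact: subdivided_flip | exact: completed_flip].
  by exists c1, c2.
have half c1 c2 d1 d2 : subdivided col z c1 c2 d1 d2 ->
    (cl (col c1) != None) && (cl (col c2) != None) ->
    completed col z [:: c1; c2; d1; d2].
  move=> sd /andP[n1 n2]; have [_ _ _ _ [e3 e4]] := sd.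
  have [d1N|] := eqVneq (cl (col d1)) None; last first.
    case d1x: (cl (col d1)) => [x|] // _; apply: (plain _ _ _ _ x) => //.
    by rewrite -d1x eq_sym -e3; apply: pc.
  case d2x: (cl (col d2)) => [x|]; last first.
    by move: (pc d1); rewrite /compat e3 d1N d2x.
  have flip := subdivided_swap (subdivided_flip (subdivided_swap sd)).
  apply/completed_swap/completed_flip/completed_swap.
  by apply: (plain _ _ _ _ x); rewrite // d1N.
move=> sd; have [/half|] := boolP ((cl (col a1) != None) && (cl (col a2) != None)).
  exact.
rewrite negb_and !negbK => /(nonplain _ _ _ _ sd)[c [c' [c'E sd' fin]]]; apply: fin.
apply: completed_swap; have sd2 := subdivided_swap sd'.
have [/half|] := boolP ((cl (col b1) != None) && (cl (col b2) != None)); first exact.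
rewrite negb_and !negbK => /(nonplain _ _ _ _ sd2)[d [d' [d'E sd3 fin]]]; apply: fin.
exact: mixed.
Qed.

End Insertion.

(** * Undoing a splitting and restoring a link *)

Section SplitOff.

Variables (V L : finType) (t : V) (src : dart L -> V) (A : {set L}).
Implicit Types (col : dart L -> color) (z : V) (W : {set V}).

(** The links of [d1] and [d3] survive as the merged links, their ends at [z] moved to the far ends
    of [d2] and [d4]; the links of [d2] and [d4] are dropped. *)
Definition split_src (d1 d2 d3 d4 : dart L) : dart L -> V := fun x =>
  if x == d1 then src (rv d2) else if x == d3 then src (rv d4) else src x.

Definition split_links (d2 d4 : dart L) : {set L} := A :\ d2.1 :\ d4.1.

Definition spare col z c : Prop := exists y,
  [/\ y.1 \in A, src y = z, src (rv y) != z, col y = switch c &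
      compat (col (rv y)) c].

Lemma dart_eq_link (x d : dart L) : x.1 = d.1 -> x = d \/ x = rv d.
Proof. by case: x d => [l b] [l' b'] /= ->; case: b b' => [] []; auto. Qed.

(** Each merged link is read as a link subdivided by [z]; [completion] then recolours the four
    ports. *)
Lemma insertion z d1 d2 d3 d4 col0 : z != t ->
  uniq [:: d1.1; d2.1; d3.1; d4.1] ->
  (forall x, x \in [:: d1; d2; d3; d4] -> [/\ x.1 \in A, src x = z, src (rv x) != z &
    forall c, reach t (split_src d1 d2 d3 d4) (split_links d2 d4) col0 c (src (rv x))]) ->
  compatible col0 ->
  exists col c, [/\ compatible col,
    forall k v, reach t (split_src d1 d2 d3 d4) (split_links d2 d4) col0 k v ->
      reach t src A col k v,
    forall x, x.1 \notin [:: d1.1; d2.1; d3.1; d4.1] -> col x = col0 x,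
    forall k, k != c -> reach t src A col k z & spare col z c].
Proof.
move=> zt u H pc0.
have [n12 n13 n14 n23 [n24 n34]] : [/\ d1.1 != d2.1, d1.1 != d3.1, d1.1 != d4.1,
    d2.1 != d3.1 & d2.1 != d4.1 /\ d3.1 != d4.1].
  move: u; rewrite /= !inE !negb_or.
  by case/and4P=> /and3P[-> -> ->] /andP[-> ->] ->.
(* Each colour of a merged link enters [z] on one half and leaves it on the other. *)
pose col1 x := if x == d2 then col0 (rv d1) else if x == rv d2 then col0 d1
  else if x == d4 then col0 (rv d3) else if x == rv d4 then col0 d3 else col0 x.
have nE (x y : dart L) : x.1 != y.1 -> (x == y = false) * (x == rv y = false) *
    (rv x == y = false) * (rv x == rv y = false).
  by move=> n; do !split; apply/eqP => E; move: n; [rewrite E eqxx|rewrite E eqxx|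
    rewrite -[x]rvK E eqxx|rewrite -[x]rvK E eqxx].
have rvn (x : dart L) : (rv x == x = false) * (x == rv x = false).
  by split; [|rewrite eq_sym]; apply/negbTE/rv_neq.
have [m21 m31 m41 m32 [m42 m43]] : [/\ d2.1 != d1.1, d3.1 != d1.1, d4.1 != d1.1,
    d3.1 != d2.1 & d4.1 != d2.1 /\ d4.1 != d3.1].
  by rewrite ![d2.1 == _]eq_sym ![d3.1 == _]eq_sym ![d4.1 == _]eq_sym.
have c1E : (col1 d1 = col0 d1) * (col1 (rv d1) = col0 (rv d1)) *
    (col1 d2 = col0 (rv d1)) * (col1 (rv d2) = col0 d1) *
    (col1 d3 = col0 d3) * (col1 (rv d3) = col0 (rv d3)) *
    (col1 d4 = col0 (rv d3)) * (col1 (rv d4) = col0 d3).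
  rewrite /col1 !(nE d1 d2) // !(nE d1 d4) // !(nE d3 d2) // !(nE d3 d4) //.
  by rewrite !(nE d4 d2) // !rvn !eqxx.
have pc1 : compatible col1.
  move=> x; have [x2|x2] := eqVneq x.1 d2.1.
    case: (dart_eq_link x2) => ->; rewrite ?rvK !c1E; last exact: pc0.
    by rewrite compatC; apply: pc0.
  have [x4|x4] := eqVneq x.1 d4.1.
    case: (dart_eq_link x4) => ->; rewrite ?rvK !c1E; last exact: pc0.
    by rewrite compatC; apply: pc0.
  by rewrite /col1 !(nE x d2) // !(nE x d4) //; apply: pc0.
have [d1s d2s d3s d4s] : [/\ d1 \in [:: d1; d2; d3; d4], d2 \in [:: d1; d2; d3; d4],
    d3 \in [:: d1; d2; d3; d4] & d4 \in [:: d1; d2; d3; d4]].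
  by rewrite !inE !eqxx !orbT.
have [A1 z1 _ _] := H _ d1s; have [A2 z2 _ _] := H _ d2s.
have [A3 z3 _ _] := H _ d3s; have [A4 z4 _ _] := H _ d4s.
have mono k v : reach t (split_src d1 d2 d3 d4) (split_links d2 d4) col0 k v ->
    reach t src A col1 k v.
  apply: reach_mono => x; rewrite !inE => /and3P[x4 x2 xA] <-{k}.
  (* A dart of a merged link is simulated by two darts through [z]. *)
  have two (d e : dart L) k : d.1 \in A -> e.1 \in A -> src (rv d) = src e ->
      col1 d = k -> col1 e = k ->
      reach t src A col1 k (src (rv e)) -> reach t src A col1 k (src d).
    move=> dA eA de dc ec r; apply: reach_dart => //.
    by rewrite de; apply: reach_dart ec _.
  have [x1|x1] := eqVneq x.1 d1.1.
    have /(@dart_eq_link x) [xE|xE] := x1; rewrite xE /split_src ?rvK !rvn !eqxx !(nE d1 d3) //.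
      by apply: (two (rv d2) d1); rewrite ?rvK ?z1 ?z2 ?c1E.
    by apply: (two (rv d1) d2); rewrite ?rvK ?z1 ?z2 ?c1E.
  have [x3|x3] := eqVneq x.1 d3.1.
    have /(@dart_eq_link x) [xE|xE] := x3;
        rewrite xE /split_src ?rvK !rvn !eqxx !(nE d3 d1) //.
      by apply: (two (rv d4) d3); rewrite ?rvK ?z3 ?z4 ?c1E.
    by apply: (two (rv d3) d4); rewrite ?rvK ?z3 ?z4 ?c1E.
  rewrite /split_src !(nE x d1) // !(nE x d3) //; apply: reach_dart => //.
  by rewrite /col1 !(nE x d2) // !(nE x d4).
have sd : subdivided t src A col1 z d1 d2 d3 d4.
  split; rewrite ?c1E //.
    have := map_uniq (f := fst) (s := [:: d1; d2; d3; d4]); exact.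
  move=> y /H[yA yz yn yr]; split=> // c; exact/mono/yr.
have [col [c [h1 h2 h3 h4 [y [ys yc yk]]]]] := completion zt pc1 sd.
exists col, c; split=> //.
- by move=> k v /mono/h3.
- move=> x; rewrite !inE !negb_or => /and4P[x1 x2 x3 x4].
  rewrite h1; first by rewrite /col1 !(nE x d2) // !(nE x d4).
  by rewrite !inE !negb_or !nE.
- by exists y; have [? ? ? _] := H _ ys.
Qed.

(** The dart [e] takes [c] and its reverse takes [switch c]. Then [z'] reaches the root in
    [switch c] through [z], by a walk that does not leave [z']; this releases the spare dart of
    [z'], which takes [c']. *)
Lemma join_off W z z' c c' col (e : dart L) : z != z' -> z' != t ->
  e.1 \notin A -> src e = z -> src (rv e) = z' ->
  (forall x, x.1 \in A -> src x \in W) ->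
  (forall x, x.1 \in A -> src x = z' -> src (rv x) != z) -> compatible col ->
  (forall k v, v \in W -> ~~ ((v == z) && (k == c)) -> ~~ ((v == z') && (k == c')) ->
     reach t src A col k v) ->
  z' \in W -> cl c = cl c' -> spare col z' c' ->
  connect (arc_off src A col (switch c) z') z t ->
  exists2 col', compatible col' &
    forall k v, v \in W -> reach t src (e.1 |: A) col' k v.
Proof.
move=> zz' z't eA ez ez' AW noe pc full z'W cc [y [yA yz' yn yc yk]] off.
have cci : switch c' = switch c by case: c c' cc {full yc yk off} => [[? ?]|] [[? ?]|].
rewrite cci in yc; pose i := switch c.
pose colA x := if x == e then c else if x == rv e then i else col x.
have eE (x : dart L) : x.1 \in A -> (x == e = false) * (x == rv e = false).
  by move=> xA; split; apply/eqP => xe; rewrite xe ?xA in xA eA; rewrite xA in eA.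
have rvA (x : dart L) : (rv x).1 = x.1 by [].
have colAE x : x.1 \in A -> colA x = col x by move=> xA; rewrite /colA !eE.
have ni : compat c i by rewrite /i; case: (c) => [[? ?]|].
have pcA : compatible colA.
  move=> x; have [xe|xe] := eqVneq x.1 e.1.
    case: (dart_eq_link xe) => ->; rewrite /colA ?rvK (negbTE (rv_neq e)) !eqxx //.
    by rewrite compatC.
  have ne (w : dart L) : w.1 != e.1 -> (w == e = false) * (w == rv e = false).
    by move=> we; split; apply/eqP => wE; rewrite wE eqxx in we.
  by rewrite /colA !ne //; apply: pc.
have mono0 k v : reach t src A col k v -> reach t src (e.1 |: A) colA k v.
  apply: reach_mono => x xA xc; apply: reach_dart; rewrite ?colAE //.
  by rewrite !inE xA orbT.
pose col' := recolor colA y c'.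
have ye : (y == e = false) * (rv y == e = false) by rewrite !eE.
have ey : (e == y = false) * (rv e == y = false).
  by split; apply/eqP => E; rewrite -E ?rvA (negbTE eA) in yA.
have eA' : e.1 \in e.1 |: A by rewrite !inE eqxx.
have z'i : reach t src (e.1 |: A) col' i z'.
  rewrite -ez'; apply: reach_dart; rewrite ?rvK ?ez //.
    by rewrite /col' /recolor ey /colA eqxx (negbTE (rv_neq e)).
  apply: off_reach off => [x xA|x xz xA]; first by rewrite !inE xA orbT.
  rewrite /col' /recolor colAE //; case: eqP => // xy.
  by rewrite xy yz' eqxx in xz.
have mono k v : reach t src A col k v -> reach t src (e.1 |: A) col' k v.
  by move/mono0 => h; apply: (recolor_reach (d := y)) h; rewrite yz' colAE // yc.
have z'c' : reach t src (e.1 |: A) col' c' z'.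
  rewrite -yz'; apply: reach_dart; first by rewrite !inE yA orbT.
    by rewrite /col' /recolor eqxx.
  apply/mono/full; first by apply: AW.
    by rewrite (negbTE (noe _ yA yz')).
  by rewrite (negbTE yn).
exists col' => [|k v vW].
  apply: compatible_recolor => //.
  by rewrite colAE // compatC.
have [/andP[/eqP-> /eqP->]|vz] := boolP ((v == z) && (k == c)).
  rewrite -ez; apply: reach_dart => //; first by rewrite /col' /recolor ey /colA eqxx.
  rewrite ez'; have [->//|cc'] := eqVneq c c'.
  apply/mono/full => //; first by rewrite eq_sym (negbTE zz').
  by rewrite (negbTE cc') andbF.
have [/andP[/eqP-> /eqP->]//|vz'] := boolP ((v == z') && (k == c')).
exact/mono/full.
Qed.

(** If the missing colours have different classes, the two darts of the link carry them. Otherwise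
    [off_either] finds an end from which [switch c] reaches the root without leaving the other end,
    and [join_off] applies. *)
Lemma join W z z' c c' col (e : dart L) : z != z' -> z != t -> z' != t ->
  e.1 \notin A -> src e = z -> src (rv e) = z' ->
  (forall x, x.1 \in A -> src x \in W) ->
  (forall x, x.1 \in A -> src x = z' -> src (rv x) != z) -> compatible col ->
  (forall k v, v \in W -> ~~ ((v == z) && (k == c)) -> ~~ ((v == z') && (k == c')) ->
     reach t src A col k v) ->
  z \in W -> z' \in W -> spare col z c -> spare col z' c' ->
  exists2 col', compatible col' &
    forall k v, v \in W -> reach t src (e.1 |: A) col' k v.
Proof.
move=> zz' zt z't eA ez ez' AW noe pc full zW z'W sz sz'.
have rvn := negbTE (rv_neq e).
have [cc|cc] := eqVneq (cl c) (cl c').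
  have ni d : cl d = cl c -> switch c != d.
    by case: c d {full sz cc} => [[? ?]|] [[? ?]|].
  have ci : switch c' = switch c by case: c c' cc {full sz sz' ni} => [[? ?]|] [[? ?]|].
  have rz : reach t src A col (switch c) z.
    by apply: full; rewrite // (negbTE (ni _ _)) ?andbF.
  have [off|off] := off_either zz' rz; first by apply: (@join_off W z z' c c' col e).
  apply: (@join_off W z' z c' c col (rv e)); rewrite ?rvK ?ci //.
  - by rewrite eq_sym.
  - by move=> x xA xz; apply/eqP => xz'; have := noe (rv x) xA xz'; rewrite rvK xz eqxx.
  - by move=> k v vW h1 h2; apply: full.
pose col' x := if x == e then c else if x == rv e then c' else col x.
have eE (x : dart L) : x.1 != e.1 -> (x == e = false) * (x == rv e = false).
  by move=> xA; split; apply/eqP => xe; rewrite xe eqxx in xA.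
have mono k v : reach t src A col k v -> reach t src (e.1 |: A) col' k v.
  apply: reach_mono => x xA xc; apply: reach_dart; first by rewrite !inE xA orbT.
  by rewrite /col' !eE //; apply: contraNneq eA => <-.
have eA' : e.1 \in e.1 |: A by rewrite !inE eqxx.
have cN : c != c' by apply: contraNneq cc => ->.
exists col' => [x|k v vW].
  have [xe|xe] := eqVneq x.1 e.1; last by rewrite /col' !eE //; apply: pc.
  case: (dart_eq_link xe) => ->; rewrite /col' ?rvK rvn !eqxx //.
  by rewrite compatC.
have [/andP[/eqP-> /eqP->]|vz] := boolP ((v == z) && (k == c)).
  rewrite -ez; apply: reach_dart => //; first by rewrite /col' eqxx.
  rewrite ez'; apply/mono/full => //; first by rewrite eq_sym (negbTE zz').
  by rewrite (negbTE cN) andbF.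
have [/andP[/eqP-> /eqP->]|vz'] := boolP ((v == z') && (k == c')).
  rewrite -ez'; apply: reach_dart => //; first by rewrite /col' rvn eqxx.
  rewrite rvK ez; apply/mono/full => //; first by rewrite eq_sym (negbTE cN) andbF.
  by rewrite (negbTE zz').
exact/mono/full.
Qed.

(** When only [z] lacks a colour, the reverse of [e] may take any compatible one. *)
Lemma attach W z y c col (e : dart L) :
  e.1 \notin A -> src e = z -> src (rv e) = y -> y != z -> compatible col ->
  (forall k v, v \in W -> ~~ ((v == z) && (k == c)) -> reach t src A col k v) ->
  y \in W ->
  exists2 col', compatible col' &
    forall k v, v \in W -> reach t src (e.1 |: A) col' k v.
Proof.
move=> eA ez ey yz pc full yW; have rvn := negbTE (rv_neq e).
pose col' x := if x == e then c else if x == rv e then switch c else col x.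
have eE (x : dart L) : x.1 != e.1 -> (x == e = false) * (x == rv e = false).
  by move=> xA; split; apply/eqP => xe; rewrite xe eqxx in xA.
have mono k v : reach t src A col k v -> reach t src (e.1 |: A) col' k v.
  apply: reach_mono => x xA xc; apply: reach_dart; first by rewrite !inE xA orbT.
  by rewrite /col' !eE //; apply: contraNneq eA => <-.
have ni : compat c (switch c) by case: (c) => [[? ?]|].
exists col' => [x|k v vW].
  have [xe|xe] := eqVneq x.1 e.1; last by rewrite /col' !eE //; apply: pc.
  case: (dart_eq_link xe) => ->; rewrite /col' ?rvK rvn !eqxx //.
  by rewrite compatC.
have [/andP[/eqP-> /eqP->]|vz] := boolP ((v == z) && (k == c)); last exact/mono/full.
rewrite -ez; apply: reach_dart; first by rewrite !inE eqxx.
  by rewrite /col' eqxx.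
by rewrite ey; apply/mono/full; rewrite // (negbTE yz).
Qed.

End SplitOff.

(** * Cuts and splitting off *)

Section Cuts.

Variables (V L : finType).
Implicit Types (src : dart L -> V) (A : {set L}) (U X Y S : {set V}).

Definition crosses src U (l : L) : bool :=
  (src (l, true) \in U) (+) (src (l, false) \in U).

Definition cut src A U : nat := \sum_(l in A) crosses src U l.

Definition separates S U : bool := (S :&: U != set0) && (S :\: U != set0).

Lemma separatesP S U : reflect
  (exists x y, [/\ x \in S, x \in U, y \in S & y \notin U]) (separates S U).
Proof.
apply: (iffP andP) => [[/set0Pn[x /setIP[xS xU]] /set0Pn[y /setDP[yS yU]]]|].
  by exists x, y.
case=> x [y [xS xU yS yU]]; split; apply/set0Pn.
  by exists x; rewrite inE xS.
by exists y; rewrite inE yU.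
Qed.

Lemma crosses_dart src U (d : dart L) :
  crosses src U d.1 = (src d \in U) (+) (src (rv d) \in U).
Proof. by case: d => l []; rewrite /crosses // addbC. Qed.

Lemma crossesC src U l : crosses src (~: U) l = crosses src U l.
Proof. by rewrite /crosses !inE addbN addNb negbK. Qed.

Lemma cutC src A U : cut src A (~: U) = cut src A U.
Proof. by apply: eq_bigr => l _; rewrite crossesC. Qed.

Lemma eq_cut src src' A U U' :
  (forall l b, l \in A -> (src' (l, b) \in U') = (src (l, b) \in U)) ->
  cut src' A U' = cut src A U.
Proof. by move=> h; apply: eq_bigr => l lA; rewrite /crosses !h. Qed.

Lemma cutD1 src A U l : l \in A -> cut src A U = crosses src U l + cut src (A :\ l) U.
Proof. by move=> lA; rewrite /cut (big_setD1 l). Qed.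

Lemma cut_submodular src A X Y :
  cut src A (X :&: Y) + cut src A (X :|: Y) <= cut src A X + cut src A Y.
Proof.
rewrite /cut -!big_split; apply: leq_sum => l _ /=; rewrite /crosses !inE.
by do 4 case: (_ \in _).
Qed.

Lemma cut_posimodular src A X Y :
  cut src A (X :\: Y) + cut src A (Y :\: X) <= cut src A X + cut src A Y.
Proof.
rewrite /cut -!big_split; apply: leq_sum => l _ /=; rewrite /crosses !inE.
by do 4 case: (_ \in _).
Qed.

(** The two cuts on the right exceed the cut of [X] by twice the number of links between [X :&: Y]
    and [X :\: Y], which [m] counts. *)
Lemma cut_parity src A X Y :
  odd (cut src A X) = odd (cut src A (X :&: Y)) (+) odd (cut src A (X :\: Y)).
Proof.
pose m l : nat := [&& src (l, true) \in X, src (l, false) \in X &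
                     (src (l, true) \in Y) (+) (src (l, false) \in Y)].
suff E : cut src A (X :&: Y) + cut src A (X :\: Y) = cut src A X + (\sum_(l in A) m l).*2.
  by rewrite -oddD E oddD odd_double addbF.
rewrite -addnn /cut -!big_split; apply: eq_bigr => l _ /=.
rewrite /m /crosses !inE.
by do 4 case: (_ \in _).
Qed.

(** A three-set analogue of posimodularity, verified link by link. It excludes three bad pairings at
    once in [split_off]. *)
Lemma cut_three src A X Y Z :
  cut src A (X :&: Y :&: Z) + cut src A (X :\: (Y :|: Z)) +
  cut src A (Y :\: (X :|: Z)) + cut src A (Z :\: (X :|: Y)) <=
  cut src A X + cut src A Y + cut src A Z.
Proof.
rewrite /cut -!big_split; apply: leq_sum => l _ /=; rewrite /crosses !inE.
by do 6 case: (_ \in _).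
Qed.

(** * Splitting off a vertex of degree four *)

Section SplitOff.

Variables (src : dart L -> V) (A : {set L}) (z : V) (S : {set V}).
Variables (d1 d2 d3 d4 : dart L).
Hypothesis darts_z : forall x, x.1 \in A -> src x = z -> x \in [:: d1; d2; d3; d4].
Hypothesis ports_z : forall x, x \in [:: d1; d2; d3; d4] ->
  [/\ x.1 \in A, src x = z & src (rv x) \in S].
Hypothesis links_uniq : uniq [:: d1.1; d2.1; d3.1; d4.1].
Hypothesis zS : z \notin S.
Hypothesis connS : forall U, separates S U -> 5 <= cut src A U.

(** The links away from [z], common to the graph before and after any splitting. *)
Let R := A :\: [set d1.1; d2.1; d3.1; d4.1].

Let restE (e1 e2 e3 e4 : dart L) : perm_eq [:: d1; d2; d3; d4] [:: e1; e2; e3; e4] ->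
  R = A :\ e1.1 :\ e2.1 :\ e3.1 :\ e4.1.
Proof.
move=> pe; apply/setP => l; rewrite !inE.
have := perm_mem (perm_map fst pe) l; rewrite /= !inE !orbA => ->.
by rewrite !negb_or -!andbA; do 4 bool_congr; rewrite ?andbA; do ?case: eqP.
Qed.

Let cut_four src' A' U (e1 e2 e3 e4 : dart L) :
  uniq [:: e1.1; e2.1; e3.1; e4.1] -> {subset [:: e1.1; e2.1; e3.1; e4.1] <= A'} ->
  cut src' A' U = crosses src' U e1.1 + crosses src' U e2.1 + crosses src' U e3.1 +
    crosses src' U e4.1 + cut src' (A' :\ e1.1 :\ e2.1 :\ e3.1 :\ e4.1) U.
Proof.
rewrite /= !inE !negb_or => /and4P[/and3P[n12 n13 n14] /andP[n23 n24] n34 _] sA.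
have [i1 i2 i3 i4] : [/\ e1.1 \in A', e2.1 \in A', e3.1 \in A' & e4.1 \in A'].
  by rewrite !sA ?inE ?eqxx ?orbT.
rewrite (@cutD1 _ _ _ e1.1) // (@cutD1 _ _ _ e2.1); last by rewrite !inE eq_sym n12.
rewrite (@cutD1 _ _ _ e3.1); last by rewrite !inE ![e3.1 == _]eq_sym n13 n23.
rewrite (@cutD1 _ _ _ e4.1); last by rewrite !inE ![e4.1 == _]eq_sym n14 n24 n34.
by rewrite !addnA.
Qed.

Let cut_rest U (e1 e2 e3 e4 : dart L) : perm_eq [:: d1; d2; d3; d4] [:: e1; e2; e3; e4] ->
  cut src A U = crosses src U e1.1 + crosses src U e2.1 + crosses src U e3.1 +
                crosses src U e4.1 + cut src R U.
Proof.
move=> pe; rewrite (restE pe); apply: cut_four.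
  by rewrite -(perm_uniq (perm_map fst pe)).
move=> l; rewrite -(perm_mem (perm_map fst pe)) => /mapP[x xs ->].
by have [] := ports_z xs.
Qed.

Let src_rest l b : l \in R -> src (l, b) != z.
Proof.
move=> lR; apply/negP => /eqP sz.
have lA : l \in A by move: lR; rewrite inE => /andP[].
have := @darts_z (l, b) lA sz; move: lR; rewrite !inE !negb_or => /andP[+ _].
by case/andP=> /andP[/andP[n1 n2] n3] n4 /or4P[]/eqP E; move: n1 n2 n3 n4; rewrite -E eqxx.
Qed.

Let rest_del U : cut src R (U :\ z) = cut src R U.
Proof. by apply: eq_cut => l b lR; rewrite !inE src_rest. Qed.

Let rest_add U : cut src R (z |: U) = cut src R U.
Proof. by apply: eq_cut => l b lR; rewrite !inE (negbTE (src_rest _ lR)). Qed.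

(** The violated cut has at least five links before the splitting, whichever side [z] is put on, and
    at most four afterwards. This forces each pair of far ends onto one side, and the two pairs onto
    different sides. *)
Let bad_pairing e2 e3 e4 : perm_eq [:: d1; d2; d3; d4] [:: d1; e2; e3; e4] ->
  ~~ [forall U, separates S U ==>
       (5 <= cut (split_src src d1 e2 e3 e4) (split_links A e2 e4) U)] ->
  exists U, [/\ src (rv d1) \in U, src (rv e2) \in U, src (rv e3) \notin U,
    src (rv e4) \notin U & cut src R U <= 4].
Proof.
move=> pe; rewrite negb_forall => /existsP[U]; rewrite negb_imply -ltnNge ltnS.
case/andP=> /separatesP[v [w [vS vU wS wU]]].
have u : uniq [:: d1.1; e2.1; e3.1; e4.1] by rewrite -(perm_uniq (perm_map fst pe)).
have port e : e \in [:: d1; e2; e3; e4] -> [/\ e.1 \in A, src e = z & src (rv e) \in S].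
  by rewrite -(perm_mem pe) => /ports_z.
have [e2s e3s e4s] : [/\ e2 \in [:: d1; e2; e3; e4], e3 \in [:: d1; e2; e3; e4] &
    e4 \in [:: d1; e2; e3; e4]] by rewrite !inE !eqxx !orbT.
have [i1 s1 p1] := port d1 (mem_head _ _); have [i2 s2 p2] := port e2 e2s.
have [i3 s3 p3] := port e3 e3s; have [i4 s4 p4] := port e4 e4s.
have Sz x : x \in S -> x != z by move=> xS; apply: contraNneq zS => <-.
have := u; rewrite /= !inE !negb_or => /and4P[/and3P[n12 n13 n14] /andP[n23 n24] n34 _].
have nE (x y : dart L) : x.1 != y.1 -> (x == y) = false.
  by move=> n; apply: contraNF n => /eqP->.
have cutE : cut (split_src src d1 e2 e3 e4) (split_links A e2 e4) U =
    ((src (rv d1) \in U) (+) (src (rv e2) \in U)) +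
    ((src (rv e3) \in U) (+) (src (rv e4) \in U)) + cut src R U.
  rewrite (@cutD1 _ _ _ d1.1); last by rewrite !inE n12 n14.
  rewrite (@cutD1 _ _ _ e3.1); last by rewrite !inE ![e3.1 == _]eq_sym n13 n23 eq_sym n34.
  have pe' : perm_eq [:: d1; d2; d3; d4] [:: e2; e4; d1; e3].
    apply: perm_trans pe _.
    by apply/permP => q /=; clear; lia.
  rewrite -(restE pe') addnA; congr (_ + _ + _).
  - rewrite crosses_dart /split_src eqxx (negbTE (rv_neq d1)) (nE (rv d1) e3) //.
    by rewrite addbC.
  - rewrite crosses_dart /split_src !(nE e3 d1, nE (rv e3) d1) 1?[_ == d1.1]eq_sym //.
    by rewrite eqxx (negbTE (rv_neq e3)) addbC.
  apply: eq_cut => l b lR; rewrite /split_src.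
  have lN e : e \in [:: d1; e2; e3; e4] -> l != e.1.
    move=> es; apply: contraTneq lR => ->; rewrite (restE pe) !inE.
    by move: es; rewrite !inE => /or4P[]/eqP->; rewrite eqxx ?andbF.
  by rewrite !nE // lN ?mem_head.
rewrite {}cutE => Ule.
(* Taking the side that contains the far end of [d1] and removing [z] does not change the cut in
   [R]. *)
pose U1 := (if src (rv d1) \in U then U else ~: U) :\ z.
have mem1 x : x \in S -> (x \in U1) = (x \in U) (+) (src (rv d1) \notin U).
  move=> /Sz xz; rewrite /U1 !inE xz /=.
  by case: ifP => _; rewrite ?inE ?addbT ?addbF.
have rest1 : cut src R U1 = cut src R U.
  by rewrite rest_del; case: ifP => _ //; rewrite cutC.
have zU1 : z \notin U1 by rewrite !inE eqxx.
have sep1 : separates S U1.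
  apply/separatesP; have [x1U|x1U] := boolP (src (rv d1) \in U).
    by exists v, w; rewrite !mem1 // x1U vU (negbTE wU).
  by exists w, v; rewrite !mem1 // x1U vU (negbTE wU).
have sep2 : separates S (z |: U1).
  case/separatesP: sep1 => x [y [xS xU yS yU]]; apply/separatesP; exists x, y.
  by rewrite !in_setU1 xU orbT negb_or Sz.
have cr1 e : src e = z -> crosses src U1 e.1 = (src (rv e) \in U1).
  by move=> ez; rewrite crosses_dart ez (negbTE zU1).
have cr2 e : src e = z -> src (rv e) \in S ->
    crosses src (z |: U1) e.1 = (src (rv e) \notin U1).
  by move=> ez eS; rewrite crosses_dart ez !in_setU1 eqxx /= (negbTE (Sz _ eS)).
have h1 := connS sep1; rewrite (cut_rest _ pe) !cr1 // rest1 !mem1 // in h1.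
have h2 := connS sep2; rewrite (cut_rest _ pe) !cr2 // rest_add rest1 !mem1 // in h2.
exists U1; rewrite !mem1 // rest1; move: Ule h1 h2; clear.
move: (cut src R U) (src (rv d1) \in U) (src (rv e2) \in U) (src (rv e3) \in U) => r.
move: (src (rv e4) \in U) => [] [] [] [] /= r1 r2 r3; by [split=> //; lia | lia].
Qed.

(** If all three pairings fail, each bad set contains the far end of [d1] and that of one other
    dart. Their common part and their three private parts then contain one far end each, so at least
    four links of [R] leave each of them: sixteen, against at most twelve by [cut_three]. *)
Lemma split_off : exists e2 e3 e4, perm_eq [:: d1; d2; d3; d4] [:: d1; e2; e3; e4] /\
  forall U, separates S U ->
    5 <= cut (split_src src d1 e2 e3 e4) (split_links A e2 e4) U.
Proof.
pose good e2 e3 e4 := [forall U, separates S U ==>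
  (5 <= cut (split_src src d1 e2 e3 e4) (split_links A e2 e4) U)].
have goodP e2 e3 e4 : perm_eq [:: d1; d2; d3; d4] [:: d1; e2; e3; e4] -> good e2 e3 e4 ->
    exists e2 e3 e4, perm_eq [:: d1; d2; d3; d4] [:: d1; e2; e3; e4] /\
    forall U, separates S U ->
    5 <= cut (split_src src d1 e2 e3 e4) (split_links A e2 e4) U.
  move=> pe /forallP g; exists e2, e3, e4; split=> // U.
  by have /implyP := g U; apply.
have pe2 : perm_eq [:: d1; d2; d3; d4] [:: d1; d2; d3; d4] by [].
have pe3 : perm_eq [:: d1; d2; d3; d4] [:: d1; d3; d2; d4].
  by apply/permP => q /=; clear; lia.
have pe4 : perm_eq [:: d1; d2; d3; d4] [:: d1; d4; d2; d3].
  by apply/permP => q /=; clear; lia.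
have [/(goodP _ _ _ pe2)//|/(bad_pairing pe2)[U2 [m12 m22 m32 m42 r2]]] := boolP (good d2 d3 d4).
have [/(goodP _ _ _ pe3)//|/(bad_pairing pe3)[U3 [m13 m33 m23 m43 r3]]] := boolP (good d3 d2 d4).
have [/(goodP _ _ _ pe4)//|/(bad_pairing pe4)[U4 [m14 m44 m24 m34 r4]]] := boolP (good d4 d2 d3).
have big (K : {set V}) (i j k l : dart L) : perm_eq [:: d1; d2; d3; d4] [:: i; j; k; l] ->
    z \notin K -> src (rv i) \in K -> src (rv j) \notin K -> src (rv k) \notin K ->
    src (rv l) \notin K -> 4 <= cut src R K.
  move=> pe zK iK jK kK lK.
  have port e : e \in [:: i; j; k; l] -> [/\ e.1 \in A, src e = z & src (rv e) \in S].
    by rewrite -(perm_mem pe) => /ports_z.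
  have [_ iz iS] := port i (mem_head _ _).
  have [_ jz jS] : [/\ j.1 \in A, src j = z & src (rv j) \in S].
    by apply: port; rewrite !inE eqxx orbT.
  have [_ kz _] : [/\ k.1 \in A, src k = z & src (rv k) \in S].
    by apply: port; rewrite !inE eqxx !orbT.
  have [_ lz _] : [/\ l.1 \in A, src l = z & src (rv l) \in S].
    by apply: port; rewrite !inE eqxx !orbT.
  have : separates S K by apply/separatesP; exists (src (rv i)), (src (rv j)).
  move/connS; rewrite (cut_rest _ pe) !crosses_dart iz jz kz lz (negbTE zK) iK.
  by rewrite (negbTE jK) (negbTE kK) (negbTE lK).
have headz e : e \in [:: d1; d2; d3; d4] -> src (rv e) != z.
  by move=> /ports_z[_ _ eS]; apply: contraNneq zS => <-.
have [n1 n2 n3 n4] : [/\ src (rv d1) != z, src (rv d2) != z, src (rv d3) != z &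
    src (rv d4) != z] by rewrite !headz ?inE ?eqxx ?orbT.
have mE := (m12, m22, m13, m33, m14, m44, negbTE m32, negbTE m42, negbTE m23, negbTE m43,
  negbTE m24, negbTE m34, n1, n2, n3, n4, eqxx).
have := cut_three src R (U2 :\ z) (U3 :\ z) (U4 :\ z); rewrite !rest_del leqNgt.
case/negP; apply: (@leq_ltn_trans 12).
  by rewrite -(@leq_add2r 0) !addn0 (leq_add (leq_add r2 r3) r4).
apply: (@leq_trans (4 + 4 + 4 + 4)) => //; apply: leq_add; first apply: leq_add;
  first apply: leq_add.
- by apply: (big _ _ _ _ _ pe2); rewrite !inE !mE.
- by apply: (big _ d2 d1 d3 d4); rewrite ?inE ?mE //; apply/permP => q /=; clear; lia.
- by apply: (big _ d3 d1 d2 d4); rewrite ?inE ?mE //; apply/permP => q /=; clear; lia.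
- by apply: (big _ d4 d1 d2 d3); rewrite ?inE ?mE //; apply/permP => q /=; clear; lia.
Qed.

End SplitOff.

End Cuts.

(** * Two reductions *)

Section Reductions.

Variables (V L : finType) (t : V).
Implicit Types (src : dart L -> V) (A : {set L}) (W : {set V}).

Definition within src A W : Prop := forall d : dart L, d.1 \in A -> src d \in W.

Definition connected5 src A W : Prop :=
  forall U, separates W U -> 5 <= cut src A U.

Definition colourable src A W : Prop :=
  exists2 col, compatible col & forall c v, v \in W -> reach t src A col c v.

Definition darts_from src A z : {set dart L} := [set d | (d.1 \in A) && (src d == z)].

Lemma card4P (T : finType) (B : {set T}) : #|B| = 4 ->
  exists a b c d, uniq [:: a; b; c; d] /\ [:: a; b; c; d] =i B.
Proof.
rewrite cardE => s4; have := enum_uniq (mem B); have := mem_enum (mem B).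
case: (enum _) s4 => [|a [|b [|c [|d [|? ?]]]]] //= _ m u.
by exists a, b, c, d.
Qed.

(** [S] may be smaller than [W :\ z]: when both ends of a link are to be split off, the other end
    has degree four and is exempt from the connectivity condition. *)
Lemma split_vertex src A (W S : {set V}) z : within src A W -> #|darts_from src A z| = 4 ->
  z \notin S -> S \subset W ->
  (forall x, x.1 \in A -> src x = z -> src (rv x) \in S) ->
  (forall U, separates S U -> 5 <= cut src A U) ->
  exists d1 d2 d3 d4, [/\ uniq [:: d1.1; d2.1; d3.1; d4.1],
    [:: d1; d2; d3; d4] =i darts_from src A z,
    within (split_src src d1 d2 d3 d4) (split_links A d2 d4) (W :\ z) &
    forall U, separates S U ->
      5 <= cut (split_src src d1 d2 d3 d4) (split_links A d2 d4) U].
Proof.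
move=> AW d4z zS SW zA conn; have [d1 [d2 [d3 [d4 [ud md]]]]] := card4P d4z.
have dP x : x \in [:: d1; d2; d3; d4] -> [/\ x.1 \in A, src x = z & src (rv x) \in S].
  by rewrite md inE => /andP[xA /eqP xz]; split=> //; apply: zA.
have ul : uniq [:: d1.1; d2.1; d3.1; d4.1].
  rewrite -[[:: _; _; _; _]]/(map fst [:: d1; d2; d3; d4]) map_inj_in_uniq //.
  move=> x y /dP[xA xz xS] /dP[yA yz _] /dart_eq_link[] // xE.
  by rewrite xE rvK yz (negbTE zS) in xS.
have darts x : x.1 \in A -> src x = z -> x \in [:: d1; d2; d3; d4].
  by move=> xA xz; rewrite md inE xA xz eqxx.
have [e2 [e3 [e4 [pe conn']]]] := split_off darts dP ul zS conn.
exists d1, e2, e3, e4; split=> //.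
- by rewrite -(perm_uniq (perm_map fst pe)).
- by move=> x; rewrite -(perm_mem pe).
have sub y : y \in S -> y \in W :\ z.
  by move=> yS; rewrite !inE (subsetP SW) // andbT; apply: contraNneq zS => <-.
have pe1 x : x \in [:: d1; e2; e3; e4] -> src (rv x) \in W :\ z.
  by rewrite -(perm_mem pe) => /dP[_ _ /sub].
move=> x /setD1P[x4 /setD1P[x2 xA]]; rewrite /split_src.
case: eqP => [_|x1]; first by apply: pe1; rewrite !inE eqxx orbT.
case: eqP => [_|x3]; first by apply: pe1; rewrite !inE eqxx !orbT.
rewrite !inE AW // andbT; apply/eqP => xz.
have := darts x xA xz; rewrite (perm_mem pe) !inE => /or4P[]/eqP xE //.
  by rewrite xE eqxx in x2.
by rewrite xE eqxx in x4.
Qed.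

Lemma unsplit src A (Q : {set V}) z d1 d2 d3 d4 col0 : z != t ->
  uniq [:: d1.1; d2.1; d3.1; d4.1] -> [:: d1; d2; d3; d4] =i darts_from src A z ->
  (forall x, x.1 \in A -> src x = z -> src (rv x) \in Q) -> z \notin Q ->
  compatible col0 ->
  (forall k v, v \in Q ->
     reach t (split_src src d1 d2 d3 d4) (split_links A d2 d4) col0 k v) ->
  exists col c, [/\ compatible col,
    forall k v, reach t (split_src src d1 d2 d3 d4) (split_links A d2 d4) col0 k v ->
      reach t src A col k v,
    forall x, x.1 \notin [:: d1.1; d2.1; d3.1; d4.1] -> col x = col0 x,
    forall k, k != c -> reach t src A col k z & spare src A col z c].
Proof.
move=> zt ul md zA zQ pc0 r0; apply: insertion => // x.
rewrite md inE => /andP[xA /eqP xz]; have xQ := zA x xA xz.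
by split=> // [|c]; [apply: contraNneq zQ => <- | apply: r0].
Qed.

(** * Deleting a link with one or both ends of degree five *)

Section Step.

Variables (src : dart L -> V) (A : {set L}) (W : {set V}).
Hypothesis tW : t \in W.
Hypothesis AW : within src A W.
Hypothesis loopless : forall d : dart L, d.1 \in A -> src d != src (rv d).
Hypothesis IH : forall src' A' W', #|A'| < #|A| -> t \in W' -> within src' A' W' ->
  connected5 src' A' W' -> colourable src' A' W'.

Let darts_del (e : dart L) : e.1 \in A ->
  darts_from src (A :\ e.1) (src e) = darts_from src A (src e) :\ e.
Proof.
move=> eA; apply/setP => x; rewrite !inE; case: (src x =P src e) => [xz|_]; last by rewrite !andbF.
rewrite !andbT; have [xA|_] := boolP (x.1 \in A); last by rewrite !andbF.
rewrite !andbT; congr (~~ _); apply/eqP/eqP => [/dart_eq_link[]// xE|->//].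
by have := loopless xA; rewrite xz xE rvK eqxx.
Qed.

Let card_del (e : dart L) : e.1 \in A -> #|darts_from src A (src e)| = 5 ->
  #|darts_from src (A :\ e.1) (src e)| = 4.
Proof.
move=> eA d5; have := cardsD1 e (darts_from src A (src e)).
by rewrite -darts_del // d5 inE eA eqxx => -[].
Qed.

Let within_del l : within src (A :\ l) W.
Proof. by move=> x /setD1P[_ /AW]. Qed.

(** Without [e], four links remain at [z] and are split off. Putting [z] back leaves at most one
    colour missing there, and [e] carries it. *)
Lemma remove_vertex (e : dart L) : e.1 \in A -> src e != t ->
  #|darts_from src A (src e)| = 5 ->
  (forall U, separates (W :\ src e) U -> 5 <= cut src (A :\ e.1) U) ->
  colourable src A W.
Proof.
set z := src e => eA zt d5 conn.
have zA x : x.1 \in A :\ e.1 -> src x = z -> src (rv x) \in W :\ z.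
  by move=> /setD1P[_ xA] xz; rewrite !inE AW // andbT -xz eq_sym loopless.
have zW : z \notin W :\ z by rewrite !inE eqxx.
have [d1 [d2 [d3 [d4 [ul md wf' conn']]]]] :=
  split_vertex (within_del (l := e.1)) (card_del eA d5) zW (subD1set _ _) zA conn.
have cA' : #|split_links (A :\ e.1) d2 d4| < #|A|.
  apply/proper_card/properP; split; last by exists e.1; rewrite // !inE eqxx !andbF.
  by apply/subsetP => l; rewrite !inE => /and4P[].
have tz : t \in W :\ z by rewrite !inE eq_sym zt.
have [col0 pc0 r0] := IH cA' tz wf' conn'.
have [col [c [pc mono _ rz _]]] := unsplit zt ul md zA zW pc0 r0.
rewrite -(setD1K eA).
apply: (attach (z := z) (c := c) (col := col) (y := src (rv e))) => //.
- by rewrite !inE eqxx.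
- by rewrite eq_sym loopless.
- move=> k v vW; have [->|vz] := eqVneq v z; first by rewrite /= => /rz.
  by move=> _; apply/mono/r0; rewrite !inE vz.
- exact: AW.
Qed.

(** Both ends are split off in turn and put back in reverse order. Each may then lack one colour,
    and [join] supplies both with the help of the spare darts. *)
Lemma remove_edge (e : dart L) : e.1 \in A -> src e != t -> src (rv e) != t ->
  #|darts_from src A (src e)| = 5 -> #|darts_from src A (src (rv e))| = 5 ->
  (forall x, x.1 \in A -> src x = src e -> src (rv x) = src (rv e) -> x = e) ->
  (forall U, separates (W :\ src e :\ src (rv e)) U -> 5 <= cut src (A :\ e.1) U) ->
  colourable src A W.
Proof.
set z := src e; set z' := src (rv e) => eA zt z't d5 d5' single conn.
have zz' : z != z' by apply: loopless.
set S := W :\ z :\ z'; have zS : z \notin S by rewrite !inE eqxx andbF.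
have z'S : z' \notin S by rewrite !inE eqxx.
pose A1 := A :\ e.1.
have noe x : x.1 \in A1 -> src x = z -> src (rv x) != z'.
  move=> /setD1P[xe xA] xz; apply/eqP => xz'.
  by rewrite (single x) ?eqxx in xe.
have noe' x : x.1 \in A1 -> src x = z' -> src (rv x) != z.
  by move=> xA xz'; apply/eqP => xz; have := noe (rv x) xA xz; rewrite rvK xz' eqxx.
have zA x : x.1 \in A1 -> src x = z -> src (rv x) \in S.
  move=> xA1 xz; have [_ xA] := setD1P xA1.
  by rewrite !inE noe // AW // andbT -xz eq_sym loopless.
have z'A x : x.1 \in A1 -> src x = z' -> src (rv x) \in S.
  move=> xA1 xz; have [_ xA] := setD1P xA1.
  by rewrite !inE noe' // AW // andbT -xz eq_sym loopless.
have SW : S \subset W by apply: subset_trans (subD1set _ _) (subD1set _ _).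
have [d1 [d2 [d3 [d4 [ul md wf1 conn1]]]]] :=
  split_vertex (within_del (l := e.1)) (card_del eA d5) zS SW zA conn.
set src1 := split_src src d1 d2 d3 d4 in wf1 conn1.
set A2 := split_links (A :\ e.1) d2 d4 in wf1 conn1.
have dP x : x \in [:: d1; d2; d3; d4] -> x.1 \in A1 /\ src x = z.
  by rewrite md inE => /andP[? /eqP].
have d1s : d1 \in [:: d1; d2; d3; d4] by rewrite inE eqxx.
have d3s : d3 \in [:: d1; d2; d3; d4] by rewrite !inE eqxx !orbT.
have keep x : src x != z -> src1 x = src x.
  move=> xz; rewrite /src1 /split_src.
  case: eqP => [xd|_]; first by rewrite xd (dP _ d1s).2 eqxx in xz.
  by case: eqP => [xd|_] //; rewrite xd (dP _ d3s).2 eqxx in xz.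
have headS x : x \in [:: d1; d2; d3; d4] -> src (rv x) \in S.
  by move=> /dP[xA xz]; apply: zA.
have linkN x : src x = z' -> x.1 \notin [:: d1.1; d2.1; d3.1; d4.1].
  move=> xz'; apply/negP => /(@mapP _ _ fst [:: d1; d2; d3; d4])[d ds].
  case/dart_eq_link=> xd.
    by move: zz'; rewrite -xz' xd (dP _ ds).2 eqxx.
  by move: z'S; rewrite -xz' xd headS.
(* With [e] gone no link joins [z] and [z'], so splitting at [z] preserves the darts leaving
   [z']. *)
have darts2 : darts_from src1 A2 z' = darts_from src A1 z'.
  apply/setP => x; rewrite [in LHS]inE.
  apply/idP/idP => [/andP[/setD1P[x4 /setD1P[x2 xA]] /eqP xz]|].
    rewrite inE xA /=; have [xZ|/keep<-] := eqVneq (src x) z; last by rewrite xz.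
    have : x \in [:: d1; d2; d3; d4] by rewrite md inE xA xZ eqxx.
    rewrite !inE => /or4P[]/eqP xE; rewrite xE ?eqxx // in x2 x4 xz.
      by move: z'S; rewrite -xz /src1 /split_src eqxx headS // !inE eqxx orbT.
    move: z'S; rewrite -xz /src1 /split_src eqxx; case: eqP => [d31|_].
      by rewrite headS // !inE eqxx orbT.
    by rewrite headS // !inE eqxx !orbT.
  rewrite inE => /andP[xA /eqP xz]; have := linkN x xz; rewrite !inE !negb_or.
  case/and4P=> _ -> _ ->; rewrite keep ?xz ?eqxx //; last by rewrite eq_sym.
  by move: xA; rewrite !inE => ->.
have S1 : S \subset W :\ z by apply: subD1set.
have head2 x : x.1 \in A2 -> src1 x = z' -> src1 (rv x) \in S.
  move=> xA xz; have : x \in darts_from src1 A2 z' by rewrite inE xA xz eqxx.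
  rewrite darts2 inE => /andP[xA1 /eqP xz']; have xS := z'A _ xA1 xz'.
  by rewrite keep //; apply: contraNneq zS => <-.
have d4' : #|darts_from src1 A2 z'| = 4.
  by rewrite darts2; apply: (card_del (e := rv e)).
have [f1 [f2 [f3 [f4 [ul' md' wf2 conn2]]]]] :=
  split_vertex wf1 d4' z'S S1 head2 conn1.
have cA' : #|split_links A2 f2 f4| < #|A|.
  apply/proper_card/properP; split; last by exists e.1; rewrite // !inE eqxx !andbF.
  by apply/subsetP => l; rewrite !inE => /and5P[_ _ _ _ /andP[]].
have tS : t \in S by rewrite !inE ![t == _]eq_sym z't zt.
have [col0 pc0 r0] := IH cA' tS wf2 conn2.
have [col1 [c' [pc1 mono1 keep1 rz' sp1]]] := unsplit z't ul' md' head2 z'S pc0 r0.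
have r1 k v : v \in S -> reach t src1 A2 col1 k v by move=> vS; apply/mono1/r0.
have [col [c [pc mono keepc rz sp]]] := unsplit zt ul md zA zS pc1 r1.
(* Putting [z] back changes only colours of links at [z], so the spare dart of [z'] is kept. *)
have sp' : spare src A1 col z' c'.
  have [y [yA yz _ yc yk]] := sp1.
  have : y \in darts_from src1 A2 z' by rewrite inE yA yz eqxx.
  rewrite darts2 inE => /andP[yA1 /eqP yz']; exists y.
  have yS := z'A _ yA1 yz'; have ln := linkN y yz'.
  rewrite (keepc y ln) (keepc (rv y) ln).
  by split=> //; apply: contraNneq z'S => <-.
suff: colourable src (e.1 |: A1) W by rewrite /A1 setD1K.
apply: (join (z := z) (z' := z') (c := c) (c' := c') (col := col)) => //.
- by rewrite !inE eqxx.
- exact: within_del.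
- move=> k v vW; have [->|vz] := eqVneq v z; first by rewrite /= => /rz.
  move=> _; have [->|vz'] := eqVneq v z'; first by rewrite /= => /rz'/mono.
  by move=> _; apply/mono/r1; rewrite !inE vz vz'.
- exact: AW.
- exact: AW.
Qed.

End Step.

End Reductions.

(** * Contracting a double 5-cycle *)

Lemma card_color : #|{: color}| = 5.
Proof. by rewrite card_option card_prod card_bool. Qed.

(** Incompatible pairs of distinct colours are disjoint, whereas a pair of the first matching always
    shares a colour with a pair of the second; so the two matchings cannot both fail. *)
Lemma match_pairs (p q r s : color) : uniq [:: p; q; r; s] ->
  if compat r q && compat s p then true else compat r p && compat s q.
Proof. by case: p q r s => [[[] []]|] [[[] []]|] [[[] []]|] [[[] []]|]. Qed.

Lemma ord5_cases (j i : 'I_5) :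
  i \in [:: j; ordS j; ordS (ordS j); ord_pred j; ord_pred (ord_pred j)].
Proof.
by case: j i => [[|[|[|[|[|j]]]]] // hj] [[|[|[|[|[|i]]]]] // hi].
Qed.

Section Pentagon.

Variables (V L : finType) (t : V) (src : dart L -> V) (A : {set L}) (W : {set V}).
Hypothesis tW : t \in W.
Hypothesis AW : within src A W.
Hypothesis conn : connected5 src A W.
Hypothesis IH : forall (src' : dart L -> V) (A' : {set L}) (W' : {set V}),
  #|A'| < #|A| -> t \in W' -> within src' A' W' -> connected5 src' A' W' -> colourable t src' A' W'.

Variables (X : {set V}) (zs : 'I_5 -> V) (fw : 'I_5 -> bool -> dart L) (g : 'I_5 -> dart L).
Hypothesis XE : forall v, v \in X <-> exists i, v = zs i.
Hypothesis zs_inj : injective zs.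
Hypothesis XW : X \subset W.
Hypothesis tX : t \notin X.
Hypothesis fwP : forall i b, [/\ (fw i b).1 \in A, src (fw i b) = zs i &
  src (rv (fw i b)) = zs (ordS i)].
Hypothesis fw_inj : forall i b j c, (fw i b).1 = (fw j c).1 -> i = j /\ b = c.
Hypothesis gP : forall i, [/\ (g i).1 \in A, src (g i) = zs i & src (rv (g i)) \notin X].
Hypothesis g_all : forall x, x.1 \in A -> src x \in X -> src (rv x) \notin X ->
  exists i, x = g i.

(** The vertex [w] stands for the whole of [X] in the contracted graph. *)
Let w := zs ord0.
Let src0 x := if src x \in X then w else src x.
Let A0 := [set l in A | ~~ ((src (l, true) \in X) && (src (l, false) \in X))].
Let W0 := w |: (W :\: X).

Let zsX i : zs i \in X. Proof. by apply/XE; exists i. Qed.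

Let A0P x : (x.1 \in A0) = (x.1 \in A) && ~~ ((src x \in X) && (src (rv x) \in X)).
Proof. by rewrite inE; case: x => l [] //=; rewrite [X in ~~ X]andbC. Qed.

Let within0 : within src0 A0 W0.
Proof.
move=> x; rewrite A0P => /andP[xA _]; rewrite /src0 !inE.
by case: ifP => xX; rewrite ?eqxx // xX AW // orbT.
Qed.

(** A cut of the contracted graph is a cut of the original one with [X] entirely on one side. *)
Let conn0 : connected5 src0 A0 W0.
Proof.
move=> U /separatesP[x [y [xW xU yW yU]]].
pose U' := if w \in U then U :|: X else U :\: X.
have mem v : (v \in U') = if v \in X then w \in U else v \in U.
  by rewrite /U'; case: ifP => wU; rewrite !inE; case: ifP => vX; rewrite ?orbT ?orbF.
have lift v : v \in W0 -> (v \in U') = (v \in U) /\ v \in W.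
  rewrite /W0 !inE mem => /orP[/eqP->|/andP[vX vW]]; last by rewrite (negbTE vX).
  by rewrite zsX; split=> //; apply/(subsetP XW)/zsX.
have [xE xW'] := lift x xW; have [yE yW'] := lift y yW.
suff -> : cut src0 A0 U = cut src A U'.
  by apply: conn; apply/separatesP; exists x, y; rewrite xE yE.
rewrite /cut [RHS](big_setID A0) /= [X in _ = _ + X]big1 ?addn0 => [|l].
  have -> : A :&: A0 = A0 by apply/setIidPr/subsetP => l; rewrite inE => /andP[].
  apply: eq_bigr => l _; rewrite /crosses !mem /src0.
  by case: (src (l, true) \in X); case: (src (l, false) \in X).
rewrite !inE negb_and negbK => /andP[/orP[/negbTE->|] // /andP[h1 h2] _].
by rewrite /crosses !mem h1 h2 addbb.
Qed.

Let cardA0 : #|A0| < #|A|.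
Proof.
apply/proper_card/properP; split; first by apply/subsetP => l; rewrite inE => /andP[].
have [fA f1 f2] := fwP ord0 true; exists (fw ord0 true).1 => //.
by rewrite A0P f1 f2 !zsX andbF.
Qed.

(* If colour [a i] leaves the cycle at its [i]-th vertex, the two darts from
   vertex [i] to vertex [i + 1] carry [a (i + 1)] and [a (i + 2)], and their
   reverses carry [a i] and [a (i - 1)], in an order that [match_pairs] makes
   compatible: each colour enters its exit from two steps away on either side. *)
Lemma contract_pentagon : colourable t src A W.
Proof.
have wX : w \in X := zsX ord0.
have wt : w != t by apply: contraNneq tX => <-.
have tW0 : t \in W0 by rewrite !inE tX tW orbT.
have [col0 pc0 r0] := IH cardA0 tW0 within0 conn0.
have src0_out x : src0 x != w -> src x \notin X /\ src0 x = src x.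
  by rewrite /src0; case: ifP => // xX; rewrite eqxx.
pose a i := col0 (g i).
pose F (p : 'I_5 * bool) := a (if p.2 then ordS (ordS p.1) else ordS p.1).
pose sw i := compat (a (ordS i)) (a i) && compat (a (ordS (ordS i))) (a (ord_pred i)).
pose B (p : 'I_5 * bool) := a (if sw p.1 (+) p.2 then p.1 else ord_pred p.1).
pose col x := if [pick p | x == fw p.1 p.2] is Some p then F p else
  if [pick p | x == rv (fw p.1 p.2)] is Some p then B p else col0 x.
have col_fw i b : col (fw i b) = F (i, b).
  rewrite /col; case: pickP => [[j c] /= /eqP E|/(_ (i, b))]; last by rewrite eqxx.
  by have [-> ->] := fw_inj (congr1 fst E).
have col_rv i b : col (rv (fw i b)) = B (i, b).
  rewrite /col; case: pickP => [[j c] /= /eqP E|_].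
    have [ij bc] := @fw_inj i b j c (congr1 fst E).
    by move: E; rewrite ij bc => E; have := rv_neq (fw j c); rewrite E eqxx.
  case: pickP => [[j c] /= /eqP E|/(_ (i, b))]; last by rewrite eqxx.
  by have [-> ->] := @fw_inj i b j c (congr1 fst E).
have col_out x : ~~ ((src x \in X) && (src (rv x) \in X)) -> col x = col0 x.
  move=> xX; rewrite /col; case: pickP => [[j c] /= /eqP E|_].
    by have [_ s1 s2] := fwP j c; rewrite E s1 s2 !zsX in xX.
  case: pickP => [[j c] /= /eqP E|_] //.
  by have [_ s1 s2] := fwP j c; rewrite E rvK s1 s2 !zsX in xX.
(* A walk that leaves [w] for good starts with one of the five links leaving [X]. *)
have exit k : exists2 i, a i = k & connect (arc_off src0 A0 col0 k w) (src0 (rv (g i))) t.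
  have [x [xA xw xk off]] := off_first wt (r0 k w (setU11 _ _)).
  move: xA; rewrite A0P => /andP[xA]; have [xX|xX] := boolP (src x \in X); last first.
    by move: xw; rewrite /src0 (negbTE xX) => xw; rewrite xw wX in xX.
  move=> /= hX; have [i xg] := g_all xA xX hX.
  by exists i; rewrite /a -xg.
(* Five colours share five exits, so each has exactly one. *)
have a_inj : injective a.
  have /image_injP h : #|image a {: 'I_5}| == #|{: 'I_5}|.
    apply/eqP; transitivity #|{: color}|; last by rewrite card_color card_ord.
    apply: eq_card => k.
    by have [i <- _] := exit k; rewrite image_f.
  by move=> i j; apply: h.
have pred_inj := can_inj (@ord_predK 5).
(* Such a walk avoids [X], where alone the colours differ from [col0]. *)
have stays k v : connect (arc_off src0 A0 col0 k w) v t -> v != w /\ reach t src A col k v.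
  case/connectP=> p; elim: p v => [|u p IHp] v /=.
    by move=> _ <-; rewrite eq_sym wt reach_root.
  case/andP=> /andP[vw /arcP[d [dA dv du dk]]] /IHp h /h[uw ru]; split=> //.
  have [dX dE] : src d \notin X /\ src0 d = src d by apply: src0_out; rewrite dv.
  have [dX' dE'] : src (rv d) \notin X /\ src0 (rv d) = src (rv d).
    by apply: src0_out; rewrite du.
  rewrite -dv dE; move: dA; rewrite A0P => /andP[dA _]; apply: reach_dart => //.
    by rewrite col_out ?(negbTE dX).
  by rewrite -dE' du.
have reachX k i : reach t src A col k (zs i).
  have [j <- /stays[hw rh]] := exit k.
  have [gA gz gX] := gP j.
  have rj : reach t src A col (a j) (zs j).
    rewrite -gz; apply: reach_dart => //; first by rewrite col_out // (negbTE gX) andbF.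
    by move: rh; rewrite /src0 (negbTE gX).
  have step x i1 i2 : x.1 \in A -> src x = zs i1 -> src (rv x) = zs i2 ->
      col x = a j -> reach t src A col (a j) (zs i2) -> reach t src A col (a j) (zs i1).
    by move=> xA <- <-; apply: reach_dart.
  have rp : reach t src A col (a j) (zs (ord_pred j)).
    have [fA f1 f2] := fwP (ord_pred j) false; apply: (step _ _ _ fA f1 f2).
      by rewrite col_fw /F /= ord_predK.
    by rewrite ord_predK.
  have rs : reach t src A col (a j) (zs (ordS j)).
    have [fA f1 f2] := fwP j (~~ sw j); apply: (step (rv (fw j (~~ sw j))) _ j fA f2).
    - by rewrite rvK.
    - by rewrite col_rv /B /= addbN addbb.
    - by [].
  have := ord5_cases j i; rewrite !inE => /or4P[|||/orP[]] /eqP-> //.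
    have [fA f1 f2] := fwP (ordS j) (sw (ordS j)).
    apply: (step (rv (fw (ordS j) (sw (ordS j)))) _ (ordS j) fA f2).
    - by rewrite rvK.
    - by rewrite col_rv /B /= addbb ordSK.
    - by [].
  have [fA f1 f2] := fwP (ord_pred (ord_pred j)) true; apply: (step _ _ _ fA f1 f2).
    by rewrite col_fw /F /= !ord_predK.
  by rewrite ord_predK.
exists col => [x|k v vW].
  have pair i b : compat (F (i, b)) (B (i, b)).
    have u : uniq (map a [:: ord_pred i; i; ordS i; ordS (ordS i)]).
      by rewrite map_inj_uniq //; case: i => [[|[|[|[|[|i]]]]] // hi].
    have := match_pairs u; rewrite /F /B /= /sw.
    by case: ifP => [/andP[h1 h2] _|_ /andP[h1 h2]]; case: b.
  have [p xp|nfw] := pickP (fun p => x == fw p.1 p.2).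
    by case: p xp => i b /eqP->; rewrite col_fw col_rv.
  have [p xp|nrv] := pickP (fun p => x == rv (fw p.1 p.2)).
    by case: p xp => i b /eqP->; rewrite rvK col_fw col_rv compatC.
  have -> : col x = col0 x.
    by rewrite /col; case: pickP => [p|_]; [rewrite nfw | case: pickP => [p|] //; rewrite nrv].
  suff -> : col (rv x) = col0 (rv x) by apply: pc0.
  rewrite /col; case: pickP => [p /eqP E|_]; first by have := nrv p; rewrite -E rvK eqxx.
  by case: pickP => [p /eqP E|_] //; have := nfw p; rewrite -[x]rvK E rvK eqxx.
have [/XE[i ->]|vX] := boolP (v \in X); first exact: reachX.
have : reach t src0 A0 col0 k v by apply: r0; rewrite !inE vX vW orbT.
(* The walk of the contracted graph is followed until it meets [X], where [reachX] takes over. *)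
move: vX; move: v {vW}; suff h v : reach t src0 A0 col0 k v -> v \notin X -> reach t src A col k v.
  by move=> v vX /h; apply.
apply: (@reach_ind _ _ t src0 A0 col0 k (fun v => v \notin X -> reach t src A col k v)).
  by rewrite reach_root.
move=> d; rewrite A0P => /andP[dA _] dk hd; rewrite /src0; case: ifP => [dX|dX _].
  by rewrite wX.
apply: reach_dart => //; first by rewrite col_out // dX.
have [/XE[i ->]|hX] := boolP (src (rv d) \in X); first exact: reachX.
by move: hd; rewrite /src0 (negbTE hX); apply.
Qed.

End Pentagon.

(** * A 2-regular graph on five vertices is a 5-cycle *)

Section FiveCycle.

Variables (T : finType) (X : {set T}) (N : T -> {set T}).
Hypothesis X5 : #|X| = 5.
Hypothesis NX : forall v, v \in X -> N v \subset X /\ #|N v| = 2.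
Hypothesis N_sym : forall u v, u \in X -> v \in N u -> u \in N v /\ u != v.

(* A vertex outside a closed set has both its neighbours outside as well. *)
Lemma no_closed (s : seq T) : uniq s -> {subset s <= X} -> 2 < size s < 5 ->
  ~ (forall u, u \in s -> {subset N u <= s}).
Proof.
move=> us sX /andP[s2 s5] closed.
have cD : #|X :\: [set x in s]| + size s = 5.
  have := cardsID [set x in s] X; rewrite X5 addnC => <-; congr (_ + _).
  rewrite -(card_uniqP us); apply: eq_card => x; rewrite !inE andbC.
  by case: (boolP (x \in s)) => // /sX.
have /card_gt0P[x /setDP[xX]] : 0 < #|X :\: [set x in s]| by move: cD s5; clear; lia.
rewrite inE => xs; have [NxX Nx2] := NX xX.
suff sub : x |: N x \subset X :\: [set x in s].
  have := subset_leq_card sub; rewrite cardsU1 Nx2.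
  have -> : x \notin N x by apply/negP => /(N_sym xX)[_]; rewrite eqxx.
  by move: cD s2; clear; lia.
apply/subsetP => y /setU1P[->|yx]; first by rewrite !inE xs.
rewrite !inE (subsetP NxX) // andbT; apply: contraNN xs => ys.
by have [xy _] := N_sym xX yx; apply: closed xy.
Qed.

(** From [z0] the cycle is followed in both directions, to [z1], [z2] and to [z4], [z3]. An early
    meeting would create a closed set of three or four vertices. *)
Lemma five_cycle : exists zs : 'I_5 -> T, [/\ injective zs,
  forall v, v \in X <-> exists i, v = zs i & forall i, zs (ordS i) \in N (zs i)].
Proof.
have other u v : u \in X -> v \in N u -> exists w, [/\ w != v, w \in X, w \in N u &
    forall x, x \in N u -> x = v \/ x = w].
  move=> uX vu; have [uN /eqP/cards2P[a [b [ab E]]]] := NX uX.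
  have [aX bX] : a \in X /\ b \in X by split; apply: (subsetP uN); rewrite E !inE eqxx ?orbT.
  move: vu; rewrite E !inE => /orP[]/eqP->; [exists b | exists a].
    by rewrite eq_sym bX !inE eqxx orbT; split=> // x; rewrite !inE => /orP[]/eqP; auto.
  by rewrite aX !inE eqxx; split=> // x; rewrite !inE => /orP[]/eqP; auto.
have [z0 z0X] : exists z0, z0 \in X by apply/card_gt0P; rewrite X5.
have [z1 z1z0] : exists z1, z1 \in N z0.
  by apply/card_gt0P; have [_ ->] := NX z0X.
have [z4 [z41 z4X z4z0 N0]] := other _ _ z0X z1z0.
have z1X : z1 \in X by apply: (subsetP (NX z0X).1).
have [z0z1 z01] := N_sym z0X z1z0; have [z0z4 z04] := N_sym z0X z4z0.
have [z2 [z20 z2X z2z1 N1]] := other _ _ z1X z0z1.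
have [z1z2 z12] := N_sym z1X z2z1.
have [z3 [z30 z3X z3z4 N4]] := other _ _ z4X z0z4.
have [z4z3 z43] := N_sym z4X z3z4.
(* Otherwise [z0], [z1], [z2] form a closed triangle. *)
have z24 : z2 != z4.
  apply/eqP => E; subst z4; have z3z1 : z3 = z1.
    by case: (N4 z1 z1z2) => // E; rewrite E eqxx in z01.
  subst z3; apply: (@no_closed [:: z0; z1; z2]) => //.
  - by rewrite /= !inE negb_or z01 eq_sym z20 z12.
  - by move=> u; rewrite !inE => /or3P[]/eqP->.
  move=> u; rewrite !inE => /or3P[]/eqP-> x; rewrite !inE.
  - by case/N0=> ->; rewrite eqxx ?orbT.
  - by case/N1=> ->; rewrite eqxx ?orbT.
  - by case/N4=> ->; rewrite eqxx ?orbT.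
have z31 : z3 != z1.
  apply/eqP => E; subst z3; case: (N1 z4 z4z3) => E; first by rewrite E eqxx in z04.
  by rewrite E eqxx in z24.
(* Otherwise [z0], [z1], [z2], [z4] form a closed 4-cycle. *)
have z32 : z3 != z2.
  apply/eqP => E; subst z3; have [w [w1 wX w2 N2]] := other _ _ z2X z1z2.
  have w4 : w = z4 by case: (N2 z4 z4z3) => // E; rewrite E eqxx in z41.
  subst w; apply: (@no_closed [:: z0; z1; z2; z4]) => //.
  - by rewrite /= !inE !negb_or z01 eq_sym z20 z04 z12 eq_sym z41 z24.
  - by move=> u; rewrite !inE => /or4P[]/eqP->.
  move=> u; rewrite !inE => /or4P[]/eqP-> x; rewrite !inE.
  - by case/N0=> ->; rewrite eqxx ?orbT.
  - by case/N1=> ->; rewrite eqxx ?orbT.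
  - by case/N2=> ->; rewrite eqxx ?orbT.
  - by case/N4=> ->; rewrite eqxx ?orbT.
have u5 : uniq [:: z0; z1; z2; z3; z4].
  rewrite /= !inE !negb_or z01 ![z0 == _]eq_sym z20 z30 [z4 == _]eq_sym z04 z12.
  by rewrite ![z1 == _]eq_sym z31 z41 [z2 == z3]eq_sym z32 z24 eq_sym z43.
have XE : [:: z0; z1; z2; z3; z4] =i X.
  have s5 : {subset [:: z0; z1; z2; z3; z4] <= X}.
    by move=> u; rewrite !inE; do 4 (case/predU1P=> [->//|]); move/eqP->.
  by apply/subset_cardP; [rewrite X5; apply/card_uniqP | apply/subsetP].
(* The second neighbour of [z3] is neither [z0] nor [z1], whose two neighbours are already known. *)
have z3z2 : z3 \in N z2.
  have [w [w4 wX w3 _]] := other _ _ z3X z4z3; have [z3w wz3] := N_sym z3X w3.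
  move: wX; rewrite -XE !inE (negbTE w4) orbF [w == z3]eq_sym (negbTE wz3) orbF.
  case/or3P=> /eqP E; subst w => //.
    case: (N0 z3 z3w) => E; first by rewrite E eqxx in z31.
    by rewrite E eqxx in z43.
  case: (N1 z3 z3w) => E; first by rewrite E eqxx in z30.
  by rewrite E eqxx in z32.
exists (fun i => nth z0 [:: z0; z1; z2; z3; z4] i); split.
- by move=> i j /eqP; rewrite nth_uniq // => /eqP/val_inj.
- move=> v; rewrite -XE; split=> [vs|[i ->]]; last by rewrite mem_nth.
  have vi : index v [:: z0; z1; z2; z3; z4] < 5 by rewrite index_mem.
  by exists (Ordinal vi); rewrite /= nth_index.
by case=> [[|[|[|[|[|i]]]]] // hi].
Qed.

End FiveCycle.

(** * Existence of the colouring *)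

Section Existence.

Variables (V L : finType) (t : V).
Implicit Types (src : dart L -> V) (A : {set L}) (U W X Y : {set V}).

Lemma card_darts A (P : pred (dart L)) :
  #|[set d : dart L | (d.1 \in A) && P d]| = \sum_(l in A) (P (l, true) + P (l, false)).
Proof.
rewrite -sum1_card (eq_bigl (fun d : dart L => (d.1 \in A) && P d)) => [|d]; last by rewrite inE.
rewrite big_mkcondr /= (eq_bigr (fun l => \sum_b (P (l, b) : nat))) => [|l _]; last first.
  by rewrite big_bool.
rewrite pair_big_dep /=; apply: eq_big => [[l b]|[l b] _] /=; first by rewrite andbT.
by case: (P _).
Qed.

Lemma cut_darts src A U :
  cut src A U = #|[set d : dart L | (d.1 \in A) && ((src d \in U) && (src (rv d) \notin U))]|.
Proof.
rewrite card_darts; apply: eq_bigr => l _; rewrite /crosses /=.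
by do 2 case: (_ \in _).
Qed.

Lemma cut_dart src A U : 0 < cut src A U ->
  exists d : dart L, [/\ d.1 \in A, src d \in U & src (rv d) \notin U].
Proof. by rewrite cut_darts card_gt0 => /set0Pn[d]; rewrite inE => /and3P[]; exists d. Qed.

(** * Graphs in which no link can be deleted *)

Section Step.

Variables (src : dart L -> V) (A : {set L}) (W : {set V}).
Hypothesis tW : t \in W.
Hypothesis AW : within src A W.
Hypothesis conn : connected5 src A W.
Hypothesis loopless : forall d : dart L, d.1 \in A -> src d != src (rv d).
Hypothesis IH : forall (src' : dart L -> V) (A' : {set L}) (W' : {set V}),
  #|A'| < #|A| -> t \in W' -> within src' A' W' -> connected5 src' A' W' -> colourable t src' A' W'.
Hypothesis critical : forall l, l \in A ->
  exists2 U, separates W U & cut src (A :\ l) U <= 4.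

Let link_to u v : {set dart L} :=
  [set d : dart L | (d.1 \in A) && ((src d == u) && (src (rv d) == v))].

Definition tight U : bool := [&& U \subset W, t \notin U, U != set0 & cut src A U == 5].

Let cut_ge U : U \subset W -> t \notin U -> U != set0 -> 5 <= cut src A U.
Proof.
move=> UW tU /set0Pn[x xU]; apply: conn; apply/separatesP.
by exists x, t; rewrite (subsetP UW).
Qed.

(** Deleting one link lowers a cut by at most one, so the cut is exactly five and [l] belongs to it;
    [Y] is the side that avoids [t]. *)
Let tight_crossing l U : l \in A -> separates W U -> cut src (A :\ l) U <= 4 ->
  exists Y, [/\ tight Y, crosses src Y l & Y = W :&: U \/ Y = W :\: U].
Proof.
move=> lA sU c4; have c5 := conn sU; have cD := cutD1 src U lA.
have cr : crosses src U l by move: cD c5 c4; case: crosses => //= ->; lia.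
have cU : cut src A U = 5 by move: cD c5 c4; rewrite cr; clear; lia.
case/andP: (sU) => n1 n2.
pose Y := if t \in U then W :\: U else W :&: U.
have Ymem l' b : l' \in A -> (src (l', b) \in Y) = (t \in U) (+) (src (l', b) \in U).
  by move=> /(AW (d := (l', b))) sW; rewrite /Y; case: ifP; rewrite !inE sW ?andbT.
exists Y; split; last by rewrite /Y; case: ifP; auto.
  have cY : cut src A Y = cut src A U.
    by apply: eq_bigr => l' l'A; rewrite /crosses !Ymem // addbACA addbb.
  rewrite /tight cY cU eqxx andbT /Y; case: ifP => tU.
    by rewrite subsetDl n2 !inE tU.
  by rewrite subsetIl n1 !inE tU andbF.
by move: cr; rewrite /crosses !Ymem // addbACA addbb.
Qed.

Let card_from z : #|darts_from src A z| = cut src A [set z].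
Proof.
rewrite cut_darts; apply: eq_card => d; rewrite !inE.
have [dA|//] := boolP (d.1 \in A); case: eqP => //= dz.
by rewrite -dz eq_sym loopless.
Qed.

Let tight_crosses e Y : tight Y -> crosses src Y e.1 -> #|Y| <= 1 ->
  Y = [set src e] \/ Y = [set src (rv e)].
Proof.
move=> /and4P[_ _ Y0 _] + Y1; have /cards1P[y ->] : #|Y| == 1.
  by rewrite eqn_leq Y1 card_gt0.
rewrite crosses_dart !inE; case: eqP => [->|_]; first by left.
by case: eqP => [->|//]; right.
Qed.

(** A cut violated after deleting [e] has a tight side crossed by [e], hence equal to [[set src e]];
    such a cut separates no two other vertices. *)
Let use_vertex e : e.1 \in A -> src e != t ->
  (forall Y, tight Y -> crosses src Y e.1 -> Y = [set src e]) -> colourable t src A W.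
Proof.
move=> eA et only; have [U sU cU] := critical eA.
have [Y [tY crY _]] := tight_crossing eA sU cU.
have d5 : #|darts_from src A (src e)| = 5.
  by rewrite card_from -(only Y tY crY); case/and4P: tY => _ _ _ /eqP.
apply: (remove_vertex tW AW loopless IH eA et d5) => U' sU'.
rewrite leqNgt; apply/negP => c4.
case/separatesP: sU' => x [y [/setD1P[xe xW] xU /setD1P[ye yW] yU]].
have sW : separates W U' by apply/separatesP; exists x, y.
have [Y' [tY' crY' YE]] := tight_crossing eA sW c4.
have Y1 := only _ tY' crY'; rewrite Y1 in YE; case: YE => /setP.
  by move/(_ x); rewrite !inE xW xU (negbTE xe).
by move/(_ y); rewrite !inE yW yU (negbTE ye).
Qed.

Let use_edge e : e.1 \in A -> tight [set src e] -> tight [set src (rv e)] ->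
  (forall x, x.1 \in A -> src x = src e -> src (rv x) = src (rv e) -> x = e) ->
  (forall Y, tight Y -> crosses src Y e.1 -> Y = [set src e] \/ Y = [set src (rv e)]) ->
  colourable t src A W.
Proof.
move=> eA /and4P[_ t1 _ /eqP c1] /and4P[_ t2 _ /eqP c2] single only.
apply: (remove_edge tW AW loopless IH eA _ _ _ _ single); rewrite ?card_from //.
- by rewrite inE eq_sym in t1.
- by rewrite inE eq_sym in t2.
move=> U' sU'; rewrite leqNgt; apply/negP => c4.
case/separatesP: sU' => x [y [/setD1P[xe' /setD1P[xe xW]] xU /setD1P[ye' /setD1P[ye yW]] yU]].
have sW : separates W U' by apply/separatesP; exists x, y.
have [Y' [tY' crY' YE]] := tight_crossing eA sW c4.
have [] := only _ tY' crY' => Y1; rewrite Y1 in YE; case: YE => /setP.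
- by move/(_ x); rewrite !inE xW xU (negbTE xe).
- by move/(_ y); rewrite !inE yW yU (negbTE ye).
- by move/(_ x); rewrite !inE xW xU (negbTE xe').
- by move/(_ y); rewrite !inE yW yU (negbTE ye').
Qed.

(** The links between [v] and the rest of [Y] are counted by both cuts on the right and not by the
    cut of [Y]. *)
Let cut_vertex Y v : v \in Y ->
  cut src A Y + (#|[set d : dart L | (d.1 \in A) && ((src d == v) && (src (rv d) \in Y))]|).*2 =
  cut src A [set v] + cut src A (Y :\ v).
Proof.
move=> vY; rewrite card_darts -addnn /cut -!big_split; apply: eq_bigr => l lA /=.
have := loopless (d := (l, true)) lA; rewrite /crosses /= !inE.
have [->|_] := eqVneq (src (l, true)) v; first by rewrite vY eq_sym => /negbTE->; case: (_ \in _).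
have [->|_ _] := eqVneq (src (l, false)) v; first by rewrite vY; case: (_ \in _).
by do 2 case: (_ \in _).
Qed.

Lemma critical_colourable v0 : v0 \in W -> v0 != t -> colourable t src A W.
Proof.
move=> v0W v0t.
(* If all tight sets are singletons, a link at [t] will do: tight sets avoid [t], so only its other
   end can be one that it crosses. *)
have [X0 /andP[X0t X02]|small] := pickP (fun X => tight X && (1 < #|X|)); last first.
  have : 5 <= cut src A (W :\ t).
    apply: cut_ge; rewrite ?subD1set ?setD11 //.
    by apply/set0Pn; exists v0; rewrite !inE v0t.
  move=> c5; have [|d [dA /setD1P[dt dW] hd]] := @cut_dart src A (W :\ t).
    by apply: leq_trans c5.
  have ht : src (rv d) = t by apply/eqP; move: hd; rewrite !inE (AW (d := rv d)) // andbT negbK.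
  apply: (use_vertex dA dt) => Y tY crY.
  have Y1 : #|Y| <= 1 by have := small Y; rewrite tY /= ltnNge => /negbFE.
  case: (tight_crosses tY crY Y1) => // E.
  by case/and4P: tY; rewrite E ht inE eqxx.
pose big (X : {set V}) := tight X && (1 < #|X|).
have big0 : big X0 by rewrite /big X0t.
case: (arg_minnP (fun X : {set V} => #|X|) big0) => X /andP[Xt X2] Xmin.
have [XW tX X0n /eqP X5] := and4P Xt.
have tN x : x \in X -> x != t by apply: contraTneq => ->.
have inside e Y : src e \in X -> src (rv e) \in X -> tight Y -> crosses src Y e.1 ->
    Y = [set src e] \/ Y = [set src (rv e)].
  move=> eX e'X tY crY; apply: tight_crosses => //; rewrite leqNgt; apply/negP => Y2.
  have [YW tYn Y0 /eqP Y5] := and4P tY.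
  have [i0 d0] : X :&: Y != set0 /\ X :\: Y != set0.
    move: crY; rewrite crosses_dart; have [eY|eY] := boolP (src e \in Y) => e'Y;
      split; apply/set0Pn;
      [exists (src e) | exists (src (rv e)) | exists (src (rv e)) | exists (src e)];
      by rewrite inE ?eX ?e'X ?eY ?e'Y //= (negbTE e'Y).
  (* If [Y] lay inside [X], minimality would give [Y = X]. *)
  have [/eqP|d'0] := eqVneq (Y :\: X) set0.
    rewrite setD_eq0 => YX; have : #|X| <= #|Y| by apply: Xmin; rewrite /big tY.
    move=> h; have YE : Y = X by apply/eqP; rewrite eqEcard YX.
    by move: d0; rewrite YE setDv eqxx.
  (* Uncrossing makes [X :&: Y] and [X :\: Y] tight, against parity. *)
  have IW : X :&: Y \subset W by apply: subset_trans XW; apply: subsetIl.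
  have c1 : 5 <= cut src A (X :&: Y) by apply: cut_ge; rewrite ?inE ?negb_and ?tX.
  have c2 : 5 <= cut src A (X :|: Y).
    apply: cut_ge; rewrite ?subUset ?XW ?inE ?negb_or ?tX //.
    by apply: contraNneq X0n; move/eqP; rewrite setU_eq0 => /andP[].
  have c3 : 5 <= cut src A (X :\: Y).
    by apply: cut_ge; rewrite ?inE ?negb_and ?tX ?orbT // (subset_trans (subsetDl _ _)).
  have c4 : 5 <= cut src A (Y :\: X).
    by apply: cut_ge; rewrite ?inE ?negb_and ?tYn ?orbT // (subset_trans (subsetDl _ _)).
  have s1 := cut_submodular src A X Y; have s2 := cut_posimodular src A X Y.
  have p := cut_parity src A X Y.
  have e1 : cut src A (X :&: Y) = 5 by move: c1 c2 s1; rewrite X5 Y5; clear; lia.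
  have e2 : cut src A (X :\: Y) = 5 by move: c3 c4 s2; rewrite X5 Y5; clear; lia.
  by move: p; rewrite X5 e1 e2.
pose insider (d : dart L) := [&& d.1 \in A, src d \in X & src (rv d) \in X].
(* If one end of an inner link has degree other than five, only the singleton of the other end can
   be tight. *)
have [d /andP[/and3P[dA dX d'X] d5]|deg5] :=
  pickP (fun d => insider d && (cut src A [set src d] != 5)).
  apply: (@use_vertex (rv d)) => //; first exact: tN.
  move=> Y tY crY; have [//|E|//] := inside d Y dX d'X tY.
  by case/and4P: tY => _ _ _; rewrite E (negbTE d5).
have tight1 d : insider d -> tight [set src d].
  move=> dI; have := deg5 d; rewrite dI => /negbFE c5; case/and3P: dI => dA dX d'X.
  rewrite /tight c5 sub1set (subsetP XW) // inE eq_sym tN //=.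
  by rewrite andbT; apply/set0Pn; exists (src d); rewrite inE.
have insider_rv d : insider (rv d) = insider d by rewrite /insider rvK [X in _ && X]andbC.
(* An inner link without a parallel link is deleted with both ends split off. Otherwise every inner
   link has a parallel one. *)
have [d /andP[dI single]|double] :=
  pickP (fun d => insider d && (#|link_to (src d) (src (rv d))| <= 1)).
  have [dA dX d'X] := and3P dI.
  apply: (use_edge dA) => [|||Y tY crY].
  - exact: tight1.
  - by apply: tight1; rewrite insider_rv.
  - move=> x xA xd xd'; move/card_le1_eqP: single; apply; last by rewrite inE xA xd xd' !eqxx.
    by rewrite inE dA !eqxx.
  - exact: inside.
pose to_X v := [set d : dart L | (d.1 \in A) && ((src d == v) && (src (rv d) \in X))].
have to_XP v d : v \in X -> d \in to_X v -> insider d /\ src d = v.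
  by move=> vX; rewrite inE => /and3P[dA /eqP dv hd]; rewrite /insider dA dv vX.
(* By [cut_vertex], [5 + 2 * #|to_X v|] is a sum of two cuts of size at least five; hence [v] has an
   inner link, and so degree five. *)
have to_X_cut v : v \in X -> (#|to_X v|).*2 = cut src A (X :\ v) /\ tight [set v].
  move=> vX; have Dv := subD1set X v.
  have c5 : 5 <= cut src A (X :\ v).
    apply: cut_ge; [exact: subset_trans Dv XW | by rewrite inE negb_and tX orbT |].
    by rewrite -card_gt0; move: X2; rewrite (cardsD1 v) vX.
  have c5' : 5 <= cut src A [set v].
    apply: cut_ge; [by rewrite sub1set (subsetP XW) | by rewrite inE eq_sym tN |].
    by apply/set0Pn; exists v; rewrite inE.
  have := cut_vertex vX; rewrite X5 -/(to_X v) => E.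
  have /card_gt0P[d /(to_XP _ _ vX)[dI dv]] : 0 < #|to_X v| by move: E c5 c5'; clear; lia.
  have tv : tight [set v] by rewrite -dv tight1.
  by split=> //; case/and4P: tv => _ _ _ /eqP c; move: E; rewrite c; clear; lia.
(* With [m] links between [u] and [v], exactly [10 - 2 * m] links leave the pair, and these are at
   least five. *)
have mult u v : u \in X -> v \in X -> u != v -> #|link_to u v| <= 2.
  move=> uX vX uv; have [_ /and4P[uW tu _ /eqP cu]] := to_X_cut u uX.
  have [_ /and4P[vW tv _ /eqP cv]] := to_X_cut v vX.
  have uY : u \in [set u; v] by rewrite !inE eqxx.
  have := cut_vertex uY.
  have -> : [set u; v] :\ u = [set v].
    by apply/setP => x; rewrite !inE; case: (x =P v) => [->|]; [rewrite eq_sym uv orbT | case: eqP].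
  have -> : [set d : dart L | (d.1 \in A) && ((src d == u) && (src (rv d) \in [set u; v]))] =
      link_to u v.
    apply/setP => d; rewrite !inE; have [dA|//] := boolP (d.1 \in A).
    by case: eqP => //= du; have := loopless dA; rewrite du eq_sym => /negbTE->.
  have : 5 <= cut src A [set u; v].
    apply: cut_ge; rewrite ?subUset ?uW ?vW //; last by apply/set0Pn; exists u.
    by rewrite inE negb_or tu.
  rewrite cu cv; move: (cut _ _ _) #|_| => a b; clear; lia.
pose N v := [set u in X | link_to v u != set0].
have NP u v : u \in X -> v \in N u -> [/\ v \in X, u \in N v, u != v & #|link_to u v| = 2].
  move=> uX; rewrite inE => /andP[vX /set0Pn[d]]; rewrite inE => /and3P[dA /eqP du /eqP dv].
  have uv : u != v by rewrite -du -dv loopless.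
  split=> //; first by rewrite inE uX; apply/set0Pn; exists (rv d); rewrite inE rvK dA du dv !eqxx.
  apply/eqP; rewrite eqn_leq mult // ltnNge; have := double d.
  by rewrite /insider dA du dv uX vX /= => ->.
have to_X_card v : v \in X -> #|to_X v| = (#|N v|).*2.
  move=> vX; rewrite -sum1_card (partition_big (fun d => src (rv d)) (mem (N v))) /=; last first.
    move=> d; rewrite inE => /and3P[dA /eqP dv hX]; rewrite inE hX /=.
    by apply/set0Pn; exists d; rewrite inE dA dv !eqxx.
  rewrite (eq_bigr (fun=> 2)) => [|u uN]; first by rewrite sum_nat_const muln2.
  have [uX _ _ <-] := NP _ _ vX uN; rewrite -sum1_card; apply: eq_bigl => d.
  rewrite !inE; case: (d.1 \in A) => //=; case: eqP => //= _.
  by case: eqP => [->|]; rewrite ?uX ?andbF.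
(* The number of inner links at [v] is even, at least three and at most five, hence four: two
   neighbours, and one link leaving [X]. *)
have degrees v : v \in X -> #|N v| = 2 /\ #|darts_from src A v :\: to_X v| = 1.
  move=> vX; have [cD /and4P[_ _ _ /eqP c5]] := to_X_cut v vX.
  have c5' : 5 <= cut src A (X :\ v).
    apply: cut_ge; [exact: subset_trans (subD1set _ _) XW | by rewrite inE negb_and tX orbT |].
    by rewrite -card_gt0; move: X2; rewrite (cardsD1 v) vX.
  have sub : to_X v \subset darts_from src A v.
    by apply/subsetP => d; rewrite !inE => /and3P[-> ->].
  have := subset_leq_card sub; rewrite cardsD (setIidPr sub) card_from c5 to_X_card //.
  by move: cD c5'; rewrite to_X_card //; clear; lia.
(* Each vertex of [X] sends out exactly one of the five links leaving [X]. *)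
have cardX : #|X| = 5.
  rewrite -X5 cut_darts; rewrite -[#|X|]sum1_card -[RHS]sum1_card.
  rewrite (partition_big (fun d => src d) (mem X)) /= => [|d]; last by rewrite inE => /and3P[].
  apply: eq_bigr => v vX; have [_ c1] := degrees v vX; rewrite -[LHS]c1 -sum1_card.
  apply: eq_bigl => d.
  rewrite !inE; case: (d.1 \in A) => //=; case: eqP => [->|]; rewrite ?andbF //=.
  by rewrite vX andbT.
have Ndeg v : v \in X -> N v \subset X /\ #|N v| = 2.
  by move=> vX; split; [apply/subsetP => u /(NP _ _ vX)[] | case: (degrees v vX)].
have Nsym u v : u \in X -> v \in N u -> u \in N v /\ u != v by move=> uX /(NP _ _ uX)[].
have [zs [zs_inj XE zsN]] := five_cycle cardX Ndeg Nsym.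
have zsX i : zs i \in X by apply/XE; exists i.
have /fin_all_exists[p pP] i : exists p : dart L * dart L, [/\ p.1 != p.2,
    p.1 \in link_to (zs i) (zs (ordS i)) & p.2 \in link_to (zs i) (zs (ordS i))].
  have [_ _ _ /eqP/cards2P[x [y [xy E]]]] := NP _ _ (zsX i) (zsN i).
  by exists (x, y); rewrite E !inE !eqxx orbT.
have /fin_all_exists[g gE] i : exists d, darts_from src A (zs i) :\: to_X (zs i) = [set d].
  by apply/cards1P/eqP; case: (degrees _ (zsX i)).
pose fw i (b : bool) := if b then (p i).1 else (p i).2.
have fwP i b : [/\ (fw i b).1 \in A, src (fw i b) = zs i & src (rv (fw i b)) = zs (ordS i)].
  have [_] := pP i; rewrite !inE /fw => /and3P[? /eqP ? /eqP ?] /and3P[? /eqP ? /eqP ?].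
  by case: b.
apply: (@contract_pentagon _ _ _ _ _ _ tW AW conn IH X zs fw g XE) => //.
- move=> i b j c /dart_eq_link E; have [_ s1 s2] := fwP i b; have [_ s3 s4] := fwP j c.
  case: E => E; move: s1 s2; rewrite E ?rvK ?s3 ?s4 => /zs_inj ij.
    move=> _; split=> //; move: E; rewrite -ij /fw; have [/eqP pn _ _] := pP j.
    by case: b c {s3 s4} => [] [] // E'; case: pn; rewrite E'.
  by move/zs_inj; rewrite -ij; case: (j) => [[|[|[|[|[|k]]]]] // hk] /(congr1 val).
- move=> i; have : g i \in [set g i] by rewrite inE.
  rewrite -gE !inE negb_and => /andP[+ /andP[gA /eqP gz]].
  by rewrite gA gz eqxx /= => hX; split.
move=> x xA xX hX; have /XE[i xi] := xX; exists i; apply/set1P; rewrite -gE !inE xA xi eqxx.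
by rewrite (negbTE hX).
Qed.

End Step.
Theorem colouring_exists src A W : t \in W -> within src A W -> connected5 src A W ->
  colourable t src A W.
Proof.
have [n] := ubnP #|A|; elim: n src A W => // n IHn src A W; rewrite ltnS => An tW AW conn.
have [v /andP[vW vt]|triv] := pickP (fun v => (v \in W) && (v != t)); last first.
  exists (fun d => if d.2 then None else Some (false, false)) => [[l []] //|c v vW].
  by have := triv v; rewrite vW /= => /negbFE/eqP->; rewrite reach_root.
have IH (src' : dart L -> V) (A' : {set L}) (W' : {set V}) : #|A'| < #|A| -> t \in W' ->
    within src' A' W' -> connected5 src' A' W' -> colourable t src' A' W'.
  by move=> A'A; apply: IHn; apply: leq_trans An.
have [l /andP[lA /forallP ok]|crit] := pickP (fun l => (l \in A) &&
    [forall U, separates W U ==> (5 <= cut src (A :\ l) U)]).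
  have smaller : #|A :\ l| < #|A| by rewrite [X in _ < X](cardsD1 l) lA.
  have [| |col pc r] := IH src (A :\ l) W smaller tW.
  - by move=> d /setD1P[_ /AW].
  - by move=> U sU; have := ok U; rewrite sU.
  exists col => // c v' /(r c); apply: reach_mono => d /setD1P[_ dA]; exact: reach_dart.
have critical l : l \in A -> exists2 U, separates W U & cut src (A :\ l) U <= 4.
  move=> lA; have := crit l; rewrite lA => /negbT/forallPn[U]; rewrite negb_imply -ltnNge ltnS.
  by case/andP; exists U.
(* A loop crosses no set, so its deletion cannot violate a cut. *)
apply: (critical_colourable tW AW conn _ IH critical vW vt) => d dA; apply/eqP => loop.
have [U sU] := critical _ dA; have := conn U sU; rewrite (cutD1 src U dA) crosses_dart loop addbb.
by rewrite add0n leqNgt ltnS => /negbTE->.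
Qed.

End Existence.

(** * Routing *)

(** A 4-cycle on the paired colours that changes the pair at each step; two steps lead to the
    partner colour. *)
Definition rotate (c : color) : color :=
  omap (fun a => (~~ a.1, if a.1 then ~~ a.2 else a.2)) c.

Lemma rotate4 c : rotate (rotate (rotate (rotate c))) = c.
Proof. by case: c => [[[] []]|]. Qed.

Lemma incompat_rotate2 c : c != None -> ~~ compat c (rotate (rotate c)) /\ c != rotate (rotate c).
Proof. by case: c => [[[] []]|]. Qed.

(** * Shortest walks in each colour *)

Section Ranks.

Variables (V L : finType) (t : V) (src : dart L -> V) (A : {set L}) (col : dart L -> color).

Fixpoint near c n v : bool :=
  if n is m.+1 then
    [exists d : dart L, [&& d.1 \in A, col d == c, src d == v & near c m (src (rv d))]]
  else v == t.

(** [h c v] is the length of a shortest walk of colour [c], and [nx v c] is its first dart. *)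
Lemma ranks (d0 : dart L) : (forall c v, reach t src A col c v) ->
  exists (nx : V -> color -> dart L) (h : color -> V -> nat), forall v c, v != t ->
    [/\ (nx v c).1 \in A, src (nx v c) = v, col (nx v c) = c & h c (src (rv (nx v c))) < h c v].
Proof.
move=> r; have ex c v : exists n, near c n v.
  apply: (reach_ind (Q := fun v => exists n, near c n v)) (r c v); first by exists 0 => /=.
  move=> d dA dc [n nd]; exists n.+1; apply/existsP; exists d.
  by apply/and4P; split=> //; apply/eqP.
pose h c v := ex_minn (ex c v).
pose step v c (d : dart L) :=
  [&& d.1 \in A, src d == v, col d == c & h c (src (rv d)) < h c v].
(* At [t] the rank is zero and no dart lowers it, so [d0] is returned there. *)
exists (fun v c => odflt d0 [pick d | step v c d]), h => v c vt.
case: pickP => [d /and4P[? /eqP ? /eqP ? ?] //|none]; exfalso.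
have [n nn min] := ex_minnP (ex c v); have hv : h c v = n.
  by rewrite /h; case: ex_minnP => m mm mmin; apply/eqP; rewrite eqn_leq min // mmin.
case: n nn hv {min} => [/eqP vE|n /existsP[d /and4P[dA dc dv dn]]] hv.
  by rewrite vE eqxx in vt.
have := none d; rewrite /step dA dc dv hv ltnS /h.
by case: ex_minnP => m _ /(_ _ dn) ->.
Qed.

End Ranks.

(** * The forwarding functions *)

Section Circular.

Variables (G : multigraph) (t : node G).

Definition dart_src (d : dart (link G)) : node G :=
  if d.2 then (ends d.1).1 else (ends d.1).2.

Local Notation src := dart_src.

(** Once the links crossing [U] have failed, no walk leaves [U]. *)
Lemma connected5_of_edge_connected : edge_connected G 5 ->
  connected5 src [set: link G] [set: node G].
Proof.
move=> conn U /separatesP[x [y [_ xU _ yU]]]; rewrite leqNgt; apply/negP => c4.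
pose F := [set l | crosses src U l].
have cF : #|F| = cut src [set: link G] U.
  rewrite -sum1_card /cut big_mkcond [RHS]big_mkcond /=; apply: eq_bigr => l _.
  by rewrite !inE; case: crosses.
have := conn F; rewrite cF => /(_ c4 x y)/connectP[p].
elim: p x xU => [|z p IHp] x xU /=; first by move=> _ yx; rewrite yx xU in yU.
case/andP=> /existsP[e /and3P[eF ex /eqP ez]] /IHp; apply.
move: eF; rewrite inE /crosses /src /=.
move: ex ez; rewrite /incident /other_end => /orP[]/eqP E; rewrite -E.
  by rewrite eqxx => <-; rewrite xU; case: (_ \in U).
by case: eqP => [<-|_] <-; rewrite ?xU //; case: (_ \in U).
Qed.

Lemma other_end_src d : other_end (src d) d.1 = src (rv d).
Proof.
case: d => e []; rewrite /other_end /src /= ?eqxx //.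
by case: eqP.
Qed.

Lemma src_links d : d.1 \in links (src d).
Proof. by rewrite inE /incident /src; case: ifP; rewrite eqxx ?orbT. Qed.

Variables (col : dart (link G) -> color) (nx : node G -> color -> dart (link G)).
Variable h : color -> node G -> nat.
Hypothesis compatible_col : compatible col.
Hypothesis nxP : forall v c, v != t ->
  [/\ src (nx v c) = v, col (nx v c) = c & h c (src (rv (nx v c))) < h c v].

(** Bouncing onto the colour of the reverse dart ensures that the link blocking [None] can block no
    other paired colour. *)
Definition turn v c : color := if c is None then col (rv (nx v None)) else rotate c.

Fixpoint choose n v c (U : {set link G}) : color :=
  if n is m.+1 then if (nx v c).1 \in U then c else choose m v (turn v c) U else c.

(* Only meaningful when [l] is incident to [v] and is not a loop. *)
Definition dart_into l v : dart (link G) := (l, v == (ends l).2).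

(** The in-port identifies the dart just travelled, and thereby the colour being followed. *)
Definition color_in v (p : option (link G)) : color :=
  if p is Some l then col (dart_into l v) else None.

(* Delivery takes at most eight changes of colour in total, so that [choose 9]
   never exhausts its fuel. *)
Definition circular : forwarding G := fun v p U =>
  Some (nx v (choose 9 v (color_in v p) U)).1.

Lemma dart_intoE d : src d != src (rv d) -> dart_into d.1 (src (rv d)) = d.
Proof.
case: d => l []; rewrite /dart_into /src /= => ne; first by rewrite eqxx.
by rewrite eq_sym (negbTE ne).
Qed.

Lemma nx_links v c : v != t -> (nx v c).1 \in links v.
Proof. by move=> /(nxP c)[vE _ _]; have := src_links (nx v c); rewrite vE. Qed.

Lemma circular_scheme : routing_scheme t circular.
Proof.
by move=> v p U vt _; exists (nx v (choose 9 v (color_in v p) U)).1; rewrite ?nx_links.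
Qed.

(** A link has only two darts, so it is used either twice by the same dart or in opposite
    directions. *)
Lemma same_link u c v c' : u != t -> v != t -> (nx u c).1 = (nx v c').1 ->
  c = c' /\ u = v \/ compat c c' /\ nx v c' = rv (nx u c).
Proof.
move=> /(nxP c)[uE cE _] /(nxP c')[vE c'E _] /esym/dart_eq_link[] E; [left | right].
  by split; [rewrite -cE -c'E E | rewrite -uE -vE E].
by split=> //; rewrite -{1}cE -{1}c'E E.
Qed.

Lemma incompat_link u c v c' : u != t -> v != t -> c != c' -> ~~ compat c c' ->
  (nx u c).1 != (nx v c').1.
Proof.
move=> ut vt cc' ncc'; apply/eqP => /(same_link ut vt)[[E _]|[E _]].
  by rewrite E eqxx in cc'.
by rewrite E in ncc'.
Qed.

(** If the links agreed, [nx v c'] would be the reverse of [nx u c] and lead to [u], making [u]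
    strictly closer than [v] in colour [c']. *)
Lemma closer_link u c v c' : u != t -> v != t -> c != c' -> h c' v <= h c' u ->
  (nx u c).1 != (nx v c').1.
Proof.
move=> ut vt cc' le; apply/eqP => /(same_link ut vt)[[E _]|[_ E]].
  by rewrite E eqxx in cc'.
have [uE _ _] := nxP c ut; have [_ _] := nxP c' vt.
by rewrite E rvK uE ltnNge le.
Qed.

Lemma first_link u v c : u != t -> v != t -> c != None -> c != col (rv (nx u None)) ->
  (nx u None).1 != (nx v c).1.
Proof.
move=> ut vt c0 cr; apply/eqP => /(same_link ut vt)[[E _]|[_ E]].
  by rewrite -E in c0.
by have [_ cE _] := nxP c vt; rewrite -E cE eqxx in cr.
Qed.

(** * Delivery under at most four failures *)

Section Resilience.

Variables (F : {set link G}) (D : nat -> {set link G}) (s : node G).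
Hypothesis DF : forall n, D n \subset F.
Hypothesis F4 : #|F| <= 4.

(** Several colours may be tried at one node within one hop, so a state is a stage inside [choose]:
    colour [c] is up next, with at least [k] units of fuel left. *)
Definition state k v c : Prop := exists n p j, [/\ k <= j <= 9,
  packet circular D s n = Some (v, p) &
  choose 9 v (color_in v p) (links v :\: D n) = choose j v c (links v :\: D n)].

(** Each hop in colour [c] lowers [h c], so the packet arrives or meets a down link. A hop restores
    the fuel to nine; a blocked attempt costs one unit. *)
Lemma travel k v c : state k.+1 v c -> delivered t circular D s \/ exists v',
  [/\ v' != t, (nx v' c).1 \in F, h c v' <= h c v & state k v' (turn v' c)].
Proof.
have [n] := ubnP (h c v); elim: n k v => // n IHn k v; rewrite ltnS => hn [m [p [j [kj pm ch]]]].
have [vt|vt] := eqVneq v t; first by left; exists m, p; rewrite pm vt.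
case: j kj ch => [|j] /andP[kj j9] //; have [vE cE hlt] := nxP c vt.
rewrite [RHS]/= inE nx_links // andbT; have [lD|lD] := boolP (_ \in D m) => ch.
  right; exists v; split=> //; first exact: (subsetP (DF m)).
  by exists m, p, j; split=> //; rewrite -ltnS kj ltnW.
have pm' : packet circular D s m.+1 = Some (src (rv (nx v c)), Some (nx v c).1).
  rewrite /= pm /= /hop /circular ch inE lD nx_links //=.
  by have := other_end_src (nx v c); rewrite vE => ->.
have [|||[v' [v't lF hv' st]]] := IHn k (src (rv (nx v c))).
- exact: leq_trans hn.
- exists m.+1, (Some (nx v c).1), 9; split=> //=.
    by rewrite (leq_trans kj).
  rewrite dart_intoE ?cE // vE; apply: contraTneq hlt => <-.
  by rewrite ltnn.
  by left.
by right; exists v'; split=> //; apply: leq_trans hv' (ltnW hlt).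
Qed.

(* [l] blocks colour [None] at [v], and [f0], ..., [f6] block the next seven
   colours. Since [l], [f0], [f1], [f2] are distinct, they are all of [F]; then
   [f3 = f0], [f4 = f1], [f5 = f2], and nothing is left for [f6]. *)
Lemma circular_delivers : delivered t circular D s.
Proof.
have st : state 9 s None by exists 0, None, 9.
have [//|[v [vt lF _ {}st]]] := travel st.
set c0 := turn v None in st; pose c1 := rotate c0; pose c2 := rotate c1; pose c3 := rotate c2.
have n0 : c0 != None.
  apply/eqP => E; have := compatible_col (nx v None).
  by have [_ -> _] := nxP None vt; rewrite -[col _]/c0 E.
have rotN c : c != None -> rotate c != None by case: c.
have n1 := rotN _ n0 : c1 != None; have n2 := rotN _ n1 : c2 != None.
have n3 := rotN _ n2 : c3 != None.
have turnE u c : c != None -> turn u c = rotate c by case: c.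
have c4 : rotate c3 = c0 by apply: rotate4.
have [//|[v0 [t0 F0 h0]]] := travel st; rewrite turnE // -/c1 => {}st.
have [//|[v1 [t1 F1 h1]]] := travel st; rewrite turnE // -/c2 => {}st.
have [//|[v2 [t2 F2 h2]]] := travel st; rewrite turnE // -/c3 => {}st.
have [//|[v3 [t3 F3 h3]]] := travel st; rewrite turnE // c4 => {}st.
have [//|[v4 [t4 F4' h4]]] := travel st; rewrite turnE // -/c1 => {}st.
have [//|[v5 [t5 F5 h5]]] := travel st; rewrite turnE // -/c2 => {}st.
have [//|[v6 [t6 F6 h6 _]]] := travel st.
have neqC c : c != None -> c != rotate c by case: c => [[[] []]|].
have [i02 d02] : ~~ compat c0 c2 /\ c0 != c2 by apply: incompat_rotate2.
have [i13 d13] : ~~ compat c1 c3 /\ c1 != c3 by apply: incompat_rotate2.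
have d01 : c0 != c1 by apply: neqC.
have d12 : c1 != c2 by apply: neqC.
have d23 : c2 != c3 by apply: neqC.
have d30 : c3 != c0 by rewrite -c4 neqC.
have l0 : (nx v None).1 != (nx v0 c0).1 by apply: closer_link; rewrite // eq_sym.
have l1 : (nx v None).1 != (nx v1 c1).1 by apply: first_link; rewrite // eq_sym.
have l2 : (nx v None).1 != (nx v2 c2).1 by apply: first_link; rewrite // eq_sym.
have l3 : (nx v None).1 != (nx v3 c3).1 by apply: first_link.
have e01 := closer_link t0 t1 d01 h1; have e12 := closer_link t1 t2 d12 h2.
have e23 := closer_link t2 t3 d23 h3.
have e02 := incompat_link t0 t2 d02 i02; have e13 := incompat_link t1 t3 d13 i13.
set l := (nx v None).1 in lF l0 l1 l2 l3; set f0 := (nx v0 c0).1 in F0 l0 e01 e02.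
set f1 := (nx v1 c1).1 in F1 l1 e01 e12 e13; set f2 := (nx v2 c2).1 in F2 l2 e12 e02 e23.
(* The four distinct links exhaust [F]. *)
have fin x : x \in F -> x \in [:: l; f0; f1; f2].
  move=> xF; apply/negPn/negP => xN; have: uniq [:: x; l; f0; f1; f2].
    by rewrite /= xN !inE !negb_or l0 l1 l2 e01 e02 e12.
  move/card_uniqP => /= c5; have := F4; rewrite leqNgt -[5]c5 subset_leq_card //.
  by apply/subsetP => y; rewrite !inE => /or4P[|||/orP[]]/eqP->.
have e30 : (nx v3 c3).1 = f0.
  have := fin _ F3; rewrite !inE ![(nx v3 c3).1 == _]eq_sym (negbTE l3) (negbTE e13) (negbTE e23).
  by rewrite !orbF => /eqP.
(* The repeated link is met in opposite directions, so [v3] is the head of the dart that was blocked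
   at [v0], and is closer than [v0] in colour [c0]. *)
have [[E _]|[_ E3]] := same_link t0 t3 (esym e30); first by rewrite E eqxx in d30.
have v30 : h c0 v3 < h c0 v0.
  by have [_ _] := nxP c0 t0; have [<- _ _] := nxP c3 t3; rewrite E3.
(* [v4] is closer than [v] in colour [c0], so the bounced link cannot be the one blocking there. *)
have l4 : l != (nx v4 c0).1.
  apply: closer_link => //; first by rewrite eq_sym.
  exact: leq_trans h4 (leq_trans (ltnW v30) h0).
have e34 := closer_link t3 t4 d30 h4; rewrite e30 in e34.
have e41 : (nx v4 c0).1 = f1.
  have := fin _ F4'; have := incompat_link t4 t2 d02 i02.
  rewrite !inE ![(nx v4 c0).1 == _]eq_sym (negbTE l4) (negbTE e34) => /negbTE E.
  by rewrite -/f2 in E; rewrite E orbF => /eqP.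
have e45 := closer_link t4 t5 d01 h5; rewrite e41 in e45.
have e35 := incompat_link t5 t3 d13 i13; rewrite e30 in e35.
have l5 : l != (nx v5 c1).1 by apply: first_link; rewrite // eq_sym.
have e52 : (nx v5 c1).1 = f2.
  have := fin _ F5; rewrite !inE (negbTE e35) ![(nx v5 c1).1 == _]eq_sym (negbTE l5) (negbTE e45).
  by move=> /eqP.
have e56 := closer_link t5 t6 d12 h6; rewrite e52 in e56.
have l6 : l != (nx v6 c2).1 by apply: first_link; rewrite // eq_sym.
have e06 := incompat_link t0 t6 d02 i02; have e46 := incompat_link t4 t6 d02 i02.
rewrite e41 in e46; have := fin _ F6.
by rewrite !inE ![(nx v6 c2).1 == _]eq_sym (negbTE l6) (negbTE e56) (negbTE e06) (negbTE e46).
Qed.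

End Resilience.

End Circular.

Theorem theorem5 (G : multigraph) (t : node G) :
  edge_connected G 5 ->
  exists f : forwarding G,
    routing_scheme t f /\ dynamically_resilient t 4 f.
Proof.
move=> conn.
(* If [t] is the only node, every packet starts at its destination. *)
have [v0 v0t|triv] := pickP (fun v : node G => v != t); last first.
  exists (fun _ _ _ => None); split=> [v|F F4 D DF s]; first by rewrite triv.
  by exists 0, None; have /eqP<- : s == t by apply/negbFE/triv.
have AW : within (@dart_src G) [set: link G] [set: node G] by move=> d _; rewrite inE.
have [col pc r] := colouring_exists (in_setT t) AW (connected5_of_edge_connected conn).
have [d0 _] := off_first v0t (r None v0 (in_setT v0)).
have [nx [h nxP]] := ranks d0 (fun c v => r c v (in_setT v)).
have {}nxP v c : v != t -> [/\ dart_src (nx v c) = v, col (nx v c) = c &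
    h c (dart_src (rv (nx v c))) < h c v] by case/(nxP v c).
exists (circular col nx); split; first exact: circular_scheme nxP.
by move=> F F4 D DF s _; exact: (circular_delivers pc nxP s DF F4).
Qed.
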